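(* Let $K$ be a field, let $\mathbb{X}\subseteq\mathbb{P}^n_K$ be a $0$-dimensional scheme with no point of $\mathrm{Supp}(\mathbb{X})$ on the hyperplane $X_0=0$, and let $0\le d\le r_{\mathbb{X}}-1$. Then $\mathbb{X}$ has CBP($d$) if and only if $\mathfrak{F}_{\widetilde R/R}\subseteq\bigoplus_{i\ge d+1}R_i$. In particular, $\mathbb{X}$ is a Cayley-Bacharach scheme if and only if $\mathfrak{F}_{\widetilde R/R}=\bigoplus_{i\ge r_{\mathbb{X}}}R_i$.
   Context: Setting. $P=K[X_0,\dots,X_n]$ has the standard grading, $I_{\mathbb{X}}\subseteq P$ is the (saturated) homogeneous vanishing ideal of $\mathbb{X}$, $R=P/I_{\mathbb{X}}$, and $\mathrm{Supp}(\mathbb{X})=\{p_1,\dots,p_s\}$ is the set of closed points. Since no $p_j$ lies on $X_0=0$, the residue class $x_0$ of $X_0$ in $R$ is a non-zerodivisor. $\mathcal{O}_{\mathbb{X},p_j}$ is the local ring at $p_j$, with residue field $\kappa(p_j)$; $\varkappa_j=\dim_K\kappa(p_j)$; $\deg(\mathbb{X})=\sum_j\dim_K\mathcal{O}_{\mathbb{X},p_j}$. $\mathrm{HF}_{\mathbb{X}}(i)=\dim_K R_i$, and $r_{\mathbb{X}}$ is the least integer such that $\mathrm{HF}_{\mathbb{X}}(i)=\deg(\mathbb{X})$ for all $i\ge r_{\mathbb{X}}$. $Q^h(R)$ is the localization of $R$ at all homogeneous non-zerodivisors; $Q^h(R)=R_{x_0}\cong\prod_{j=1}^s\mathcal{O}_{\mathbb{X},p_j}[T_j,T_j^{-1}]$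 with $\deg T_j=1$, via the injection $\tilde\imath:R\to Q^h(R)$, $\tilde\imath(f)=(f_{p_1}T_1^i,\dots,f_{p_s}T_s^i)$ for $f\in R_i$, where $f_{p_j}$ is the germ of $f$ at $p_j$ (the image of $f/x_0^i$ in $\mathcal{O}_{\mathbb{X},p_j}$). Conductor. $\widetilde R=\prod_{j=1}^s\mathcal{O}_{\mathbb{X},p_j}[T_j]$, which contains $R$ via $\tilde\imath$, and $\mathfrak{F}_{\widetilde R/R}=\{f\in\widetilde R\mid f\widetilde R\subseteq R\}$ (an ideal of both $R$ and $\widetilde R$). Cayley-Bacharach. A subscheme $\mathbb{Y}\subseteq\mathbb{X}$ is a $p_j$-subscheme if $\mathcal{O}_{\mathbb{Y},p_k}=\mathcal{O}_{\mathbb{X},p_k}$ for $k\ne j$ and $\mathcal{O}_{\mathbb{X},p_j}\to\mathcal{O}_{\mathbb{Y},p_j}$ is surjective; it is maximal if $\deg(\mathbb{Y})=\deg(\mathbb{X})-\varkappa_j$. Maximal $p_j$-subschemes correspond bijectively to the ideals $\langle s_j\rangle$ of $\mathcal{O}_{\mathbb{X},p_j}$ generated by a nonzero socle element $s_j$ (with $\mathcal{O}_{\mathbb{Y},p_j}=\mathcal{O}_{\mathbb{X},p_j}/\langle s_j\rangle$). For $a\in\mathcal{O}_{\mathbb{X},p_j}$ put $\mu(a)=\min\{i\in\mathbb{N}\mid(0,\dots,0,aT_j^i,0,\dots,0)\in\tilde\imath(R)\}$ (entry in position $j$). If $e_{j1},\dots,e_{j\varkappa_j}\in\mathcal{O}_{\mathbb{X},p_j}$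 have residue classes forming a $K$-basis of $\kappa(p_j)$, put $\mu_{\mathbb{Y}/\mathbb{X}}=\max_k\mu(e_{jk}s_j)$ (independent of the choices). $\deg_{\mathbb{X}}(p_j)$ is the minimum of $\mu_{\mathbb{Y}/\mathbb{X}}$ over all maximal $p_j$-subschemes $\mathbb{Y}$; one has $\deg_{\mathbb{X}}(p_j)\le r_{\mathbb{X}}$. $\mathbb{X}$ has the Cayley-Bacharach property of degree $d$, CBP($d$), if $\deg_{\mathbb{X}}(p_j)\ge d+1$ for all $j$; $\mathbb{X}$ is a Cayley-Bacharach scheme if it has CBP($r_{\mathbb{X}}-1$), i.e. $\deg_{\mathbb{X}}(p_j)=r_{\mathbb{X}}$ for all $j$. *)

(* Defs.v *)
From HB Require Import structures.
From mathcomp Require Import all_boot all_order all_algebra.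
From mathcomp Require Import generic_quotient boolp classical_sets.
From mathcomp Require Import freeg mpoly ring.

(* The scheme X is given by its saturated homogeneous vanishing ideal in      *)
(* P = K[X_0,...,X_n], points are relevant homogeneous primes of P, and local *)
(* rings are homogeneous localizations.  The ring R = P/I_X is not built as   *)
(* a type: its homogeneous parts are the spaces P_i modulo I_X, and its copy  *)
(* inside Rtilde is the image of the map itilde, defined on P.                *)

Set Implicit Arguments.
Unset Strict Implicit.
Unset Printing Implicit Defensive.

Import Order.TTheory GRing.Theory Num.Theory.

Local Open Scope classical_set_scope.
Local Open Scope ring_scope.
Local Open Scope quotient_scope.

(* The least element of A (0 if A is empty). *)
Definition least (A : set nat) : nat :=
  xget 0%N [set m | A m /\ forall k, A k -> (m <= k)%N].

Section Dimension.
Variables (K : fieldType) (V : lmodType K).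
Implicit Types U W : set V.

(* e is a family in U whose residue classes form a K-basis of U/(U :&: W). *)
Definition residue_basis U W m (e : 'I_m -> V) : Prop :=
  [/\ forall k, U (e k),
      forall u, U u -> exists c : 'I_m -> K, W (u - \sum_k c k *: e k)
    & forall c : 'I_m -> K, W (\sum_k c k *: e k) -> forall k, c k = 0].

(* dim_K U/(U :&: W), with the convention 0 if it is infinite. *)
Definition quot_dim U W : nat :=
  xget 0%N [set m | exists e : 'I_m -> V, residue_basis U W e].

End Dimension.

Section Scheme.
Variables (K : fieldType) (n : nat).

Local Notation P := {mpoly K[n.+1]}.
Local Notation X0 := ('X_(ord0 : 'I_n.+1) : P).

Definition homogeneous_ideal (I : set P) : Prop :=
  [/\ I 0,
      forall f g, I f -> I g -> I (f + g),
      forall h f, I f -> I (h * f)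
    & forall f i, I f -> I (pihomog mdeg i f)].

Definition saturated (I : set P) : Prop :=
  forall f, (exists N, forall g, g \is N.-homog -> I (g * f)) -> I f.

(* Closed subschemes of P^n_K; the unit ideal gives the empty subscheme. *)
Record proj_scheme := ProjScheme {
  vanishing_ideal : set P;
  vanishing_ideal_homogeneous : homogeneous_ideal vanishing_ideal;
  vanishing_ideal_saturated : saturated vanishing_ideal
}.

(* Points of P^n_K.  Properness of prime_ideal follows from prime_relevant.   *)
Record proj_point := ProjPoint {
  prime_ideal : set P;
  prime_homogeneous : homogeneous_ideal prime_ideal;
  prime_relevant : exists i : 'I_n.+1, ~ prime_ideal 'X_i;
  prime_mul : forall f g,
    prime_ideal (f * g) -> prime_ideal f \/ prime_ideal g
}.

Record pt_of (X : proj_scheme) := PtOf {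
  ppoint :> proj_point;
  pt_of_sub : vanishing_ideal X `<=` prime_ideal ppoint
}.

Definition subscheme (Y X : proj_scheme) : Prop :=
  vanishing_ideal X `<=` vanishing_ideal Y.

(* A point y lies in the closure of x iff the prime of x is contained in that *)
(* of y.                                                                      *)
Definition closed_point (X : proj_scheme) (x : pt_of X) : Prop :=
  forall y : pt_of X, prime_ideal x `<=` prime_ideal y ->
    prime_ideal y = prime_ideal x.

(* X is nonempty and has no chain of two distinct irreducible closed subsets. *)
Definition zero_dimensional (X : proj_scheme) : Prop :=
  inhabited (pt_of X) /\
  forall x y : pt_of X, prime_ideal x `<=` prime_ideal y ->
    prime_ideal x = prime_ideal y.

Definition enumerates_Supp (X : proj_scheme) s (p : 'I_s -> pt_of X) : Prop :=
  injective p /\ forall x, closed_point x <-> exists j, p j = x.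

Lemma prime1 (x : proj_point) : ~ prime_ideal x 1.
Proof.
case: x => I [_ _ IM _] [i ni] _ /= I1; apply: ni.
by rewrite -['X_i]mulr1; apply: IM.
Qed.

Section Fractions.
Variable x : proj_point.

(* The denominators: homogeneous elements of degree d outside the prime. *)
Definition denom d (b : P) : Prop := b \is d.-homog /\ ~ prime_ideal x b.

Lemma denomM d e b c : denom d b -> denom e c -> denom (d + e) (b * c).
Proof.
by move=> [hb nb] [hc nc]; split; [exact: dhomogM | case/prime_mul].
Qed.

Lemma denom1 : denom 0 1.
Proof. by split; [exact: dhomog1 | exact: prime1]. Qed.

Definition is_frac (ab : P * P) : bool :=
  `[< exists d, ab.1 \is d.-homog /\ denom d ab.2 >].

Record frac := MkFrac { fval :> P * P; fvalP : is_frac fval }.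

HB.instance Definition _ := [isSub for fval].
HB.instance Definition _ := [Choice of frac by <:].

Lemma fracP (u : frac) : exists d, u.1 \is d.-homog /\ denom d u.2.
Proof. exact/asboolP/fvalP. Qed.

Lemma is_frac0 : is_frac (0, 1).
Proof. by apply/asboolP; exists 0%N; split; [exact: dhomog0|exact: denom1]. Qed.

(* The fraction a / b, with the convention 0 / 1 if the pair is not legal. *)
Definition Frac (a b : P) : frac := insubd (MkFrac is_frac0) (a, b).

Lemma val_Frac d a b : a \is d.-homog -> denom d b -> fval (Frac a b) = (a, b).
Proof.
by move=> ha hb; rewrite /Frac val_insubd ifT //; apply/asboolP; exists d.
Qed.

Lemma Frac_val (u : frac) : Frac u.1 u.2 = u.
Proof.
have [d [hu1 hu2]] := fracP u.
by apply: val_inj; rewrite /= (val_Frac hu1 hu2) -surjective_pairing.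
Qed.

End Fractions.

Section LocalRing.
Variables (X : proj_scheme) (x : proj_point).

Local Notation I := (vanishing_ideal X).
Local Notation dom := (frac x).

Let I0 : I 0. Proof. by case: (vanishing_ideal_homogeneous X). Qed.
Let ID f g : I f -> I g -> I (f + g).
Proof. by case: (vanishing_ideal_homogeneous X) => _ h _ _; apply: h. Qed.
Let IM h f : I f -> I (h * f).
Proof. by case: (vanishing_ideal_homogeneous X) => _ _ h' _; apply: h'. Qed.

Definition frac_eq (u v : dom) : bool :=
  `[< exists c d, denom x d c /\ I (c * (u.1 * v.2 - v.1 * u.2)) >].

Lemma frac_eq_refl : reflexive frac_eq.
Proof.
move=> u; apply/asboolP; exists 1, 0%N.
by split; [exact: denom1 | rewrite subrr mulr0].
Qed.

Lemma frac_eq_sym u v : frac_eq u v = frac_eq v u.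
Proof.
suff sub u0 v0 : frac_eq u0 v0 -> frac_eq v0 u0.
  by apply/idP/idP; apply: sub.
move=> /asboolP [c [d [hc Ic]]]; apply/asboolP; exists c, d; split=> //.
by rewrite (_ : _ * _ = (- 1) * (c * (u0.1 * v0.2 - v0.1 * u0.2)));
  [exact: IM | ring].
Qed.

Lemma frac_eq_trans : transitive frac_eq.
Proof.
move=> v u w /asboolP [c [d [hc Ic]]] /asboolP [c' [d' [hc' Ic']]].
have [e [_ hv]] := fracP v.
apply/asboolP; exists (c * c' * v.2), (d + d' + e)%N; split.
  by do 2?[apply: denomM].
rewrite (_ : _ * _ = (c' * w.2) * (c * (u.1 * v.2 - v.1 * u.2))
             + (c * u.2) * (c' * (v.1 * w.2 - w.1 * v.2))); last by ring.
by apply: ID; apply: IM.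
Qed.

Canonical frac_equiv :=
  EquivRel frac_eq frac_eq_refl frac_eq_sym frac_eq_trans.

(* The local ring O_{X,x}, i.e. the degree 0 part of the localization of      *)
(* P/I_X at the homogeneous elements outside the prime of x.  It is the zero  *)
(* ring if x does not lie on X.                                               *)
Definition local_ring : Type := {eq_quot frac_eq}.
HB.instance Definition _ : EqQuotient _ frac_eq local_ring :=
  EqQuotient.on local_ring.
HB.instance Definition _ := Choice.on local_ring.

Local Notation O := local_ring.

Lemma local_ringP (u v : dom) :
  (exists c d, denom x d c /\ I (c * (u.1 * v.2 - v.1 * u.2))) <->
  \pi_O u = \pi_O v.
Proof.
split=> [h|/eqmodP /asboolP //].
by apply/eqmodP; apply/asboolP.
Qed.

Let repP (u : dom) : exists c d, denom x d c /\
  I (c * (u.1 * (repr (\pi_O u)).2 - (repr (\pi_O u)).1 * u.2)).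
Proof. by apply/local_ringP; rewrite reprK. Qed.

Definition addf (u v : dom) : dom :=
  Frac x (u.1 * v.2 + v.1 * u.2) (u.2 * v.2).
Definition oppf (u : dom) : dom := Frac x (- u.1) u.2.
Definition mulf (u v : dom) : dom := Frac x (u.1 * v.1) (u.2 * v.2).
Definition scalef (k : K) (u : dom) : dom := Frac x (k *: u.1) u.2.

Lemma addfE u v :
  addf u v = (u.1 * v.2 + v.1 * u.2, u.2 * v.2) :> P * P.
Proof.
have [d [hu1 hu2]] := fracP u; have [e [hv1 hv2]] := fracP v.
apply: (@val_Frac _ (d + e)%N); last exact: denomM.
apply: dhomogD; first by apply: dhomogM => //; case: hv2.
by rewrite addnC; apply: dhomogM => //; case: hu2.
Qed.

Lemma oppfE u : oppf u = (- u.1, u.2) :> P * P.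
Proof.
have [d [hu1 hu2]] := fracP u.
by apply: (@val_Frac _ d) => //; rewrite rpredN.
Qed.

Lemma mulfE u v : mulf u v = (u.1 * v.1, u.2 * v.2) :> P * P.
Proof.
have [d [hu1 hu2]] := fracP u; have [e [hv1 hv2]] := fracP v.
by apply: (@val_Frac _ (d + e)%N); [exact: dhomogM | exact: denomM].
Qed.

Lemma scalefE k u : scalef k u = (k *: u.1, u.2) :> P * P.
Proof.
have [d [hu1 hu2]] := fracP u.
by apply: (@val_Frac _ d) => //; rewrite rpredZ.
Qed.

Definition fracE := (addfE, oppfE, mulfE, scalefE).

Definition local_add := lift_op2 O addf.
Definition local_opp := lift_op1 O oppf.
Definition local_mul := lift_op2 O mulf.
Definition local_scale k := lift_op1 O (scalef k).

Lemma pi_add : {morph \pi : u v / addf u v >-> local_add u v}.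
Proof.
move=> u v; unlock local_add; apply/local_ringP; rewrite !fracE /=.
have [c [d [hc Ic]]] := repP u; have [c' [d' [hc' Ic']]] := repP v.
exists (c * c'), (d + d')%N; split; first exact: denomM.
set u' := repr _ in Ic *; set v' := repr _ in Ic' *.
rewrite (_ : _ * _ = (c' * v.2 * v'.2) * (c * (u.1 * u'.2 - u'.1 * u.2))
   + (c * u.2 * u'.2) * (c' * (v.1 * v'.2 - v'.1 * v.2))); last by ring.
by apply: ID; apply: IM.
Qed.
Canonical pi_add_morph := PiMorph2 pi_add.

Lemma pi_opp : {morph \pi : u / oppf u >-> local_opp u}.
Proof.
move=> u; unlock local_opp; apply/local_ringP; rewrite !fracE /=.
have [c [d [hc Ic]]] := repP u; exists c, d; split=> //.
set u' := repr _ in Ic *.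
by rewrite (_ : _ * _ = - 1 * (c * (u.1 * u'.2 - u'.1 * u.2)));
  [exact: IM | ring].
Qed.
Canonical pi_opp_morph := PiMorph1 pi_opp.

Lemma pi_mul : {morph \pi : u v / mulf u v >-> local_mul u v}.
Proof.
move=> u v; unlock local_mul; apply/local_ringP; rewrite !fracE /=.
have [c [d [hc Ic]]] := repP u; have [c' [d' [hc' Ic']]] := repP v.
exists (c * c'), (d + d')%N; split; first exact: denomM.
set u' := repr _ in Ic *; set v' := repr _ in Ic' *.
rewrite (_ : _ * _ = (c' * v.1 * v'.2) * (c * (u.1 * u'.2 - u'.1 * u.2))
   + (c * u'.1 * u.2) * (c' * (v.1 * v'.2 - v'.1 * v.2))); last by ring.
by apply: ID; apply: IM.
Qed.
Canonical pi_mul_morph := PiMorph2 pi_mul.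

Lemma pi_scale k : {morph \pi : u / scalef k u >-> local_scale k u}.
Proof.
move=> u; unlock local_scale; apply/local_ringP; rewrite !fracE /=.
have [c [d [hc Ic]]] := repP u; exists c, d; split=> //.
set u' := repr _ in Ic *.
rewrite -!scalerAl -scalerBr -scalerAr -mul_mpolyC.
exact: IM.
Qed.
Canonical pi_scale_morph k := PiMorph1 (pi_scale k).

Lemma pi_eq (u v : dom) :
  u.1 * v.2 = v.1 * u.2 -> \pi_O u = \pi_O v.
Proof.
move=> e; apply/local_ringP; exists 1, 0%N; split; first exact: denom1.
by rewrite e subrr mulr0.
Qed.

Let Frac01 : Frac x 0 1 = (0, 1) :> P * P.
Proof. by apply: (@val_Frac _ 0); [exact: dhomog0 | exact: denom1]. Qed.
Let Frac11 : Frac x 1 1 = (1, 1) :> P * P.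
Proof. by apply: (@val_Frac _ 0); [exact: dhomog1 | exact: denom1]. Qed.

Lemma local_addA : associative local_add.
Proof.
elim/quotW=> u; elim/quotW=> v; elim/quotW=> w; rewrite -!pi_add.
by apply: pi_eq; rewrite !fracE /=; ring.
Qed.

Lemma local_addC : commutative local_add.
Proof.
elim/quotW=> u; elim/quotW=> v; rewrite -!pi_add.
by apply: pi_eq; rewrite !fracE /=; ring.
Qed.

Lemma local_add0 : left_id (\pi_O (Frac x 0 1)) local_add.
Proof.
elim/quotW=> u; rewrite -!pi_add.
by apply: pi_eq; rewrite !fracE Frac01 /=; ring.
Qed.

Lemma local_addN : left_inverse (\pi_O (Frac x 0 1)) local_opp local_add.
Proof.
elim/quotW=> u; rewrite -pi_opp -pi_add.
by apply: pi_eq; rewrite !fracE Frac01 /=; ring.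
Qed.

HB.instance Definition _ := GRing.isZmodule.Build O
  local_addA local_addC local_add0 local_addN.

Lemma local_mulA : associative local_mul.
Proof.
elim/quotW=> u; elim/quotW=> v; elim/quotW=> w; rewrite -!pi_mul.
by apply: pi_eq; rewrite !fracE /=; ring.
Qed.

Lemma local_mulC : commutative local_mul.
Proof.
elim/quotW=> u; elim/quotW=> v; rewrite -!pi_mul.
by apply: pi_eq; rewrite !fracE /=; ring.
Qed.

Lemma local_mul1 : left_id (\pi_O (Frac x 1 1)) local_mul.
Proof.
elim/quotW=> u; rewrite -!pi_mul.
by apply: pi_eq; rewrite !fracE Frac11 /=; ring.
Qed.

Lemma local_mulD : left_distributive local_mul local_add.
Proof.
elim/quotW=> u; elim/quotW=> v; elim/quotW=> w.
rewrite -!pi_add -!pi_mul -pi_add.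
by apply: pi_eq; rewrite !fracE /=; ring.
Qed.

HB.instance Definition _ := GRing.Zmodule_isComPzRing.Build O
  local_mulA local_mulC local_mul1 local_mulD.

Lemma local_scaleA k l (u : O) :
  local_scale k (local_scale l u) = local_scale (k * l) u.
Proof.
elim/quotW: u => u; rewrite -!pi_scale.
by apply: pi_eq; rewrite !fracE /= scalerA.
Qed.

Lemma local_scale1 : left_id 1 local_scale.
Proof.
elim/quotW=> u; rewrite -!pi_scale.
by apply: pi_eq; rewrite !fracE /= scale1r.
Qed.

Lemma local_scaleDr : right_distributive local_scale +%R.
Proof.
move=> k; elim/quotW=> u; elim/quotW=> v.
rewrite -[_ + _]pi_add -!pi_scale -[RHS]pi_add.
by apply: pi_eq; rewrite !fracE /= -!mul_mpolyC; ring.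
Qed.

Lemma local_scaleDl (u : O) : {morph local_scale^~ u : k l / k + l}.
Proof.
move=> k l; elim/quotW: u => u; rewrite -!pi_scale -[RHS]pi_add.
by apply: pi_eq; rewrite !fracE /= -!mul_mpolyC mpolyCD; ring.
Qed.

HB.instance Definition _ := GRing.Zmodule_isLmodule.Build K O
  local_scaleA local_scale1 local_scaleDr local_scaleDl.

End LocalRing.

(* The canonical map O_{X,x} -> O_{Y,x}, a/b |-> a/b, for a subscheme Y of X; *)
(* it does not depend on the representative once I_X is contained in I_Y.     *)
Definition restrict (X Y : proj_scheme) (x : proj_point) (u : local_ring X x) :
  local_ring Y x := \pi_(local_ring Y x) (repr u).

(* O_{X,x} for a point x of X, as a nonzero ring. *)
Definition stalk (X : proj_scheme) (x : pt_of X) : Type := local_ring X x.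

Section Stalk.
Variables (X : proj_scheme) (x : pt_of X).

HB.instance Definition _ := GRing.ComPzRing.on (stalk x).

Lemma stalk1_neq0 : 1 != 0 :> stalk x.
Proof.
apply/eqP => /local_ringP [c [d [[_ nc]]]].
have v11 := @val_Frac x 0 1 1 (dhomog1 _ _) (denom1 x).
have v01 := @val_Frac x 0 0 1 (dhomog0 _ _ _) (denom1 x).
by rewrite v11 v01 /= !mulr1 subr0 mulr1 => /(@pt_of_sub X x).
Qed.

HB.instance Definition _ := GRing.PzSemiRing_isNonZero.Build (stalk x)
  stalk1_neq0.
HB.instance Definition _ := GRing.Lmodule.on (stalk x).

Definition maximal_ideal : set (stalk x) :=
  [set u | exists2 v : frac x, prime_ideal x v.1 & u = \pi_(local_ring X x) v].

Definition socle : set (stalk x) :=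
  [set u | forall v, maximal_ideal v -> v * u = 0].

(* varkappa, the degree over K of the residue field of x. *)
Definition residue_degree : nat := quot_dim [set: stalk x] maximal_ideal.

(* The germ f / X_0^i of a homogeneous f of degree i (meaningful if x does    *)
(* not lie on the hyperplane X_0 = 0).                                        *)
Definition germ (i : nat) (f : P) : stalk x :=
  \pi_(local_ring X x) (Frac x f (X0 ^+ i)).

End Stalk.

Definition hilbert_function (X : proj_scheme) (i : nat) : nat :=
  quot_dim [set f : P | f \is i.-homog] (vanishing_ideal X).

(* In the rest, p enumerates the closed points of X. *)
Section CayleyBacharach.
Variables (X : proj_scheme) (s : nat) (p : 'I_s -> pt_of X).

(* The degree of a closed subscheme Y of X; the points of X outside Y         *)
(* contribute dim_K 0 = 0.                                                    *)
Definition degree (Y : proj_scheme) : nat :=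
  \sum_(j < s) quot_dim [set: local_ring Y (p j)] [set 0%R].

(* r_X, the least such integer.  It is a natural number because HF_X vanishes *)
(* in negative degrees, whereas deg(X) > 0.                                   *)
Definition regularity_index : nat :=
  least [set r | forall i, (r <= i)%N -> hilbert_function X i = degree X].

Definition Rtilde : Type := forall j : 'I_s, {poly stalk (p j)}.

(* The components of f have degree less than msize f. *)
Definition itilde (f : P) : Rtilde :=
  fun j => \poly_(i < msize f) germ (p j) i (pihomog mdeg i f).

(* The image of R_e + R_(e+1) + ... in Rtilde. *)
Definition R_ge (e : int) : set Rtilde :=
  [set itilde f | f in [set f : P |
    forall i : nat, i%:Z < e -> pihomog mdeg i f = 0]].

(* The image of R in Rtilde. *)
Definition R_image : set Rtilde := range itilde.

Definition conductor : set Rtilde :=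
  [set f : Rtilde | forall g : Rtilde, R_image (fun j => f j * g j)].

(* (0, ..., 0, a T_j^i, 0, ..., 0) *)
Definition single (j : 'I_s) (a : stalk (p j)) (i : nat) : Rtilde :=
  dfwith (fun k => 0 : {poly stalk (p k)}) (a *: 'X^i).

Definition mu (j : 'I_s) (a : stalk (p j)) : nat :=
  least [set i | R_image (single a i)].

Definition is_pj_subscheme (j : 'I_s) (Y : proj_scheme) : Prop :=
  [/\ subscheme Y X,
      forall k, k != j -> bijective (@restrict X Y (p k))
    & forall v, exists u, @restrict X Y (p j) u = v].

Definition is_maximal_pj_subscheme (j : 'I_s) (Y : proj_scheme) : Prop :=
  is_pj_subscheme j Y /\ (degree Y + residue_degree (p j))%N = degree X.

(* sj is a nonzero socle element with O_{Y,p_j} = O_{X,p_j} / <sj>. *)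
Definition socle_generator (j : 'I_s) (Y : proj_scheme) (sj : stalk (p j)) :
  Prop :=
  [/\ socle sj, sj <> 0
    & forall u : stalk (p j),
        @restrict X Y (p j) u = 0 <-> exists v, u = v * sj].

(* mu_{Y/X}.  The maximum does not depend on the choice of sj and e, so that  *)
(* the set below has a single element when Y is a maximal p_j-subscheme.      *)
Definition mu_subscheme (j : 'I_s) (Y : proj_scheme) : nat :=
  least [set m | exists (sj : stalk (p j))
                        (e : 'I_(residue_degree (p j)) -> stalk (p j)),
    [/\ socle_generator Y sj,
        residue_basis [set: stalk (p j)] (@maximal_ideal X (p j)) e
      & m = \max_k mu (e k * sj)%R]].

(* deg_X(p_j) *)
Definition point_degree (j : 'I_s) : nat :=
  least [set mu_subscheme j Y | Y in is_maximal_pj_subscheme j].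

(* The degree is an integer since r_X - 1 may be -1. *)
Definition CBP (d : int) : Prop :=
  forall j, d + 1 <= (point_degree j)%:Z.

Definition cayley_bacharach_scheme : Prop := CBP (regularity_index%:Z - 1).

End CayleyBacharach.

End Scheme.

Arguments R_ge {K n X s} p e.
Arguments R_image {K n X s} p.
Arguments conductor {K n X s} p.

(* Main.v *)
(* Every relevant homogeneous prime containing I_X is one of the p_j, so a     *)
(* homogeneous ideal containing I_X and contained in no p_j contains a power  *)
(* of the irrelevant ideal.  Applied to (I_X : f), this and saturation show   *)
(* that an element of R all of whose germs vanish is 0; applied to (I_X, X_0),*)
(* it shows that R_(i+1) = x_0 R_i for large i.  Hence the germs of all       *)
(* homogeneous elements at p_j form a finite-dimensional algebra, in which    *)
(* units have their inverses, so it is the whole local ring O_j; it follows   *)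
(* that O_j is finite-dimensional with nilpotent maximal ideal, and that R_i  *)
(* maps onto prod_j O_j for large i, which happens iff HF_X(i) = deg(X).      *)
(*                                                                            *)
(* Let C_(j,i) be the ideal of all a in O_j such that (0,..,a v T_j^i,..,0)   *)
(* lies in R for every v in O_j.  The conductor is the sum of the             *)
(* C_(j,i) T_j^i.  On the other hand deg_X(p_j) <= i iff C_(j,i) <> 0, because*)
(* a nonzero ideal of O_j contains a nonzero socle element, and a socle       *)
(* element s generates the kernel of O_(X,p_j) -> O_(Y,p_j) for a maximal     *)
(* p_j-subscheme Y, with mu_(Y/X) <= i iff <s> is contained in C_(j,i).       *)

From HB Require Import structures.
From mathcomp Require Import all_boot all_order all_algebra.
From mathcomp Require Import generic_quotient boolp classical_sets.
From mathcomp Require Import freeg mpoly ring.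
Require Import Defs.

Set Implicit Arguments.
Unset Strict Implicit.
Unset Printing Implicit Defensive.

Import Order.TTheory GRing.Theory Num.Theory.

Local Open Scope classical_set_scope.
Local Open Scope ring_scope.
Local Open Scope quotient_scope.

(** * Least elements and dimensions *)

(** The proof runs through [isolated i a]: the tuple with a T_j^i at position j and 0 elsewhere
    comes from a form of degree i. By [conductorP], an element of Rtilde lies in the conductor iff
    all O_j-multiples of each of its coefficients are isolated in the degree of that coefficient. By
    [point_degree_leP], deg_X(p_j) <= i iff some nonzero a in O_j has all its multiples isolated in
    degree i. Hence a nonzero T_j^i-coefficient occurs in the conductor iff deg_X(p_j) <= i, which
    gives [CBP_conductor]. Equality in the second statement also needs [R_ge_regularity]: from
    degree r_X on, every tuple of germs is attained ([germs_onto_regularity]).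

    The link between deg_X(p_j) and ideals of O_j rests on [socle_generator_maximal] and
    [socle_subscheme_maximal], which pass between maximal p_j-subschemes and socle elements.
    Zero-dimensionality enters through [irrelevant_ideal], from which [germs_inj], [stalk_germ] and
    the finiteness of the stalks follow. *)

Section LeastElement.

Lemma leastP (A : set nat) : A !=set0 ->
  A (least A) /\ forall k, A k -> (least A <= k)%N.
Proof.
move=> [a Aa].
apply: (@xgetPex _ 0%N [set m | A m /\ forall k, A k -> (m <= k)%N]).
have exA : exists k, `[< A k >] by exists a; apply/asboolP.
case: (ex_minnP exA) => m /asboolP Am minm; exists m; split=> // k Ak.
by apply: minm; apply/asboolP.
Qed.

(** The form in which [mu], [mu_subscheme] and [point_degree] are handled; nonemptiness excludes the
    default value 0 of [least]. *)
Lemma least_leP (A : set nat) i : A !=set0 ->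
  (least A <= i)%N <-> exists2 k, A k & (k <= i)%N.
Proof.
move=> /leastP [Al minl]; split; first by move=> ?; exists (least A).
by case=> k /minl; apply: leq_trans.
Qed.

End LeastElement.

(** * Bases and dimensions modulo a subspace *)

Section LinearAlgebra.
Variables (K : fieldType) (V : lmodType K).
Implicit Types U W : set V.

Definition subspace W := W 0 /\ forall (c : K) u v, W u -> W v -> W (c *: u + v).

Lemma subspace0 W : subspace W -> W 0. Proof. by case. Qed.
Lemma subspaceD W u v : subspace W -> W u -> W v -> W (u + v).
Proof. by case=> _ h Wu Wv; rewrite -[u]scale1r; apply: h. Qed.
Lemma subspaceZ W c u : subspace W -> W u -> W (c *: u).
Proof. by case=> W0 h Wu; rewrite -[_ *: _]addr0; apply: h. Qed.
Lemma subspaceN W u : subspace W -> W u -> W (- u).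
Proof. by move=> sW Wu; rewrite -scaleN1r; apply: subspaceZ. Qed.
Lemma subspaceB W u v : subspace W -> W u -> W v -> W (u - v).
Proof. by move=> sW Wu Wv; apply: subspaceD => //; apply: subspaceN. Qed.
Lemma subspace_sum W (T : Type) (r : seq T) (F : T -> V) :
  subspace W -> (forall t, W (F t)) -> W (\sum_(t <- r) F t).
Proof.
move=> sW WF; elim: r => [|t r ih]; first by rewrite big_nil; apply: subspace0.
by rewrite big_cons; apply: subspaceD.
Qed.
Lemma subspaceT : subspace setT. Proof. by []. Qed.
Lemma subspace_set0 : subspace [set 0].
Proof. by split=> // c u v -> ->; rewrite scaler0 addr0. Qed.


Definition spans U W (T : finType) (e : T -> V) :=
  forall u, U u -> exists c : T -> K, W (u - \sum_k c k *: e k).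

Definition independent W (T : finType) (e : T -> V) :=
  forall c : T -> K, W (\sum_k c k *: e k) -> forall k, c k = 0.

(** Arbitrary finite index types allow bases to be glued along disjoint sums and dependent pairs. *)
Definition fin_basis U W (T : finType) (e : T -> V) :=
  [/\ forall k, U (e k), spans U W e & independent W e].

Lemma fin_basis_enum U W (T : finType) (e : T -> V) :
  fin_basis U W e -> residue_basis U W (fun i : 'I_#|T| => e (enum_val i)).
Proof.
case=> Ue spe inde; split=> // [u Uu|c].
  have [c Wc] := spe u Uu; exists (fun i => c (enum_val i)).
  rewrite (reindex (fun i : 'I_#|T| => enum_val i)) in Wc; first exact: Wc.
  exact/onW_bij/(@enum_val_bij T).
move=> Wc k; rewrite -(enum_valK k); apply: (inde (fun t => c (enum_rank t))).
rewrite (reindex (fun i : 'I_#|T| => enum_val i)); last first.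
  exact/onW_bij/(@enum_val_bij T).
by under eq_bigr do rewrite enum_valK.
Qed.

(* Expressing f through e modulo W gives a matrix whose row kernel yields     *)
(* relations between the f_k.                                                 *)
Lemma independent_matrix W m k (e : 'I_m -> V) (f : 'I_k -> V) :
  subspace W -> independent W f -> spans (range f) W e ->
  exists2 A : 'M[K]_(k, m), row_free A &
    forall i, W (f i - \sum_l A i l *: e l).
Proof.
move=> sW indf spe.
have /choice [c Wc] : forall i, exists c : 'I_m -> K, W (f i - \sum_l c l *: e l).
  by move=> i; apply: spe; exists i.
pose A := \matrix_(i, l) c i l.
have WA i : W (f i - \sum_l A i l *: e l) by under eq_bigr do rewrite mxE.
exists A => //; apply: inj_row_free => v vA; apply/rowP => t; rewrite [RHS]mxE.
apply: (indf (fun t => v 0 t)).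
have -> : \sum_k0 v 0 k0 *: f k0 =
    \sum_k0 v 0 k0 *: (f k0 - \sum_l A k0 l *: e l).
  apply/eqP; rewrite -subr_eq0 -sumrB.
  under eq_bigr do rewrite scalerBr subKr scaler_sumr.
  rewrite exchange_big /=; apply/eqP/big1 => l _.
  under eq_bigr do rewrite scalerA; rewrite -scaler_suml.
  move/rowP/(_ l): vA; rewrite !mxE => ->; exact: scale0r.
by apply: subspace_sum => // i; apply: subspaceZ.
Qed.

Lemma independent_leq W m k (e : 'I_m -> V) (f : 'I_k -> V) :
  subspace W -> independent W f -> spans (range f) W e -> (k <= m)%N.
Proof.
move=> sW indf spe; have [A rA _] := independent_matrix sW indf spe.
by rewrite -(eqP rA) rank_leq_col.
Qed.

(** The families have equal length, so the row-free matrix expressing f through e is square and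
    invertible; its inverse turns coordinates in e into coordinates in f. *)
Lemma independent_spans U W m (e f : 'I_m -> V) :
  subspace W -> independent W f -> spans (range f) W e ->
  spans U W e -> spans U W f.
Proof.
move=> sW indf spe spU u /spU [c Wc].
have [A rA WA] := independent_matrix sW indf spe.
have uA : A \in unitmx by rewrite -row_free_unit.
pose B := (\row_l c l) *m invmx A.
exists (fun k => B 0 k).
have -> : u - \sum_k B 0 k *: f k = (u - \sum_k c k *: e k)
    - \sum_k B 0 k *: (f k - \sum_l A k l *: e l).
  have -> : \sum_k B 0 k *: (f k - \sum_l A k l *: e l) =
      \sum_k B 0 k *: f k - \sum_l \sum_k B 0 k *: (A k l *: e l).
    rewrite [X in _ = _ - X]exchange_big -sumrB; apply: eq_bigr => i _.
    by rewrite scalerBr scaler_sumr.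
  have -> : \sum_l \sum_k B 0 k *: (A k l *: e l) = \sum_l c l *: e l.
    apply: eq_bigr => l _; under eq_bigr do rewrite scalerA.
    rewrite -scaler_suml; congr (_ *: _).
    have /rowP/(_ l) : B *m A = \row_l c l by rewrite mulmxKV.
    by rewrite !mxE.
  by rewrite opprB addrA subrK.
apply: subspaceB => //; apply: subspace_sum => // k.
exact: subspaceZ.
Qed.

Lemma residue_basis_uniq U W m k (e : 'I_m -> V) (f : 'I_k -> V) :
  subspace W -> residue_basis U W e -> residue_basis U W f -> m = k.
Proof.
move=> sW [Ue spe inde] [Uf spf indf]; apply/eqP; rewrite eqn_leq.
rewrite (independent_leq sW inde (e := f)); last by move=> _ [i _ <-]; apply: spf.
by rewrite (independent_leq sW indf (e := e)) // => _ [i _ <-]; apply: spe.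
Qed.

Lemma quot_dim_basis U W m (e : 'I_m -> V) :
  subspace W -> residue_basis U W e -> quot_dim U W = m.
Proof.
move=> sW be; apply: xget_unique; first by exists e.
by move=> k [f bf]; apply: residue_basis_uniq bf be.
Qed.

Lemma quot_dim_fin_basis U W (T : finType) (e : T -> V) :
  subspace W -> fin_basis U W e -> quot_dim U W = #|T|.
Proof. by move=> sW /fin_basis_enum; apply: quot_dim_basis. Qed.

(** A longest independent family in U is a basis; m bounds the lengths, so [quot_dim] is a true
    dimension here and not its default. *)
Lemma exists_residue_basis U W m (e : 'I_m -> V) :
  subspace W -> spans U W e ->
  exists f : 'I_(quot_dim U W) -> V, residue_basis U W f.
Proof.
move=> sW spe.
pose P k := `[< exists f : 'I_k -> V, (forall i, U (f i)) /\ independent W f >].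
have exP : exists k, P k.
  by exists 0%N; apply/asboolP; exists (fun=> 0); split=> [[]//|c _ []].
have boundP k : P k -> (k <= m)%N.
  move=> /asboolP [f [Uf indf]]; apply: (independent_leq sW indf (e := e)).
  by move=> _ [i _ <-]; apply: spe.
case: (ex_maxnP exP boundP) => k /asboolP [f [Uf indf]] maxk.
have bf : residue_basis U W f.
  split=> // u Uu; apply: contrapT => nu.
  suff /maxk : P k.+1 by rewrite ltnn.
  apply/asboolP; exists (fun i => oapp f u (unlift ord0 i)); split.
    by move=> i; case: (unliftP ord0 i) => [j|] _ /=.
  move=> c; rewrite big_ord_recl unlift_none /=.
  under eq_bigr do rewrite liftK /=; move=> Wc.
  have c0 : c ord0 = 0.
    apply/eqP; apply: contrapT => /negP c0; apply: nu.
    (* Dividing the relation by the coefficient of u would express u through f. *)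
    exists (fun i => - ((c ord0)^-1 * c (fintype.lift ord0 i))).
    have := subspaceZ (c ord0)^-1 sW Wc.
    rewrite scalerDr scalerA mulVf // scale1r scaler_sumr -sumrN.
    by congr (W (_ + _)); apply: eq_bigr => i _; rewrite scaleNr opprK scalerA.
  move: Wc; rewrite c0 scale0r add0r => /indf cl i.
  by case: (unliftP ord0 i) => [j|] ->.
by rewrite (quot_dim_basis sW bf); exists f.
Qed.

Lemma fin_basis_tower U V' W (T1 T2 : finType) (e1 : T1 -> V) (e2 : T2 -> V) :
  subspace U -> subspace V' -> W `<=` V' -> V' `<=` U ->
  fin_basis V' W e1 -> fin_basis U V' e2 ->
  fin_basis U W
    (fun t : T1 + T2 => match t with inl t => e1 t | inr t => e2 t end).
Proof.
move=> sU sV WV VU [V1 sp1 ind1] [U2 sp2 ind2]; split.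
- by case=> t //; apply/VU/V1.
- move=> u /sp2 [c2 Vc2]; have [c1 Wc1] := sp1 _ Vc2.
  exists (fun t => match t with inl t => c1 t | inr t => c2 t end).
  by rewrite big_sumType /= [X in _ - X]addrC opprD addrA.
- move=> c; rewrite big_sumType /= => Wc.
  have c2 t : c (inr t) = 0.
    apply: (ind2 (fun t => c (inr t))); have := WV _ Wc.
    move=> /subspaceB - /(_ (\sum_i c (inl i) *: e1 i) sV).
    rewrite [X in V' (X - _)]addrC addrK; apply.
    by apply: subspace_sum => // i; apply: subspaceZ.
  case=> t //; apply: (ind1 (fun t => c (inl t))); move: Wc.
  by rewrite [X in _ + X]big1 ?addr0 // => i _; rewrite c2 scale0r.
Qed.

End LinearAlgebra.

Lemma fin_basis_image (K : fieldType) (V V' : lmodType K) (g : {linear V -> V'})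
    (T : finType) (e : T -> V) :
  (forall v, exists u, g u = v) ->
  fin_basis setT [set u | g u = 0] e -> fin_basis setT [set 0] (g \o e).
Proof.
move=> surg [_ spe inde].
have gsum (c : T -> K) : g (\sum_k c k *: e k) = \sum_k c k *: g (e k).
  by rewrite linear_sum; apply: eq_bigr => k _; rewrite linearZ.
split=> // [v _|c /= gc].
  have [u <-] := surg v; have [c /= gc] := spe u I; exists c.
  by rewrite /= -gsum -raddfB.
by apply: inde; rewrite /= gsum.
Qed.

(** * Homogeneous ideals and primes *)

Section Polynomials.
Variables (K : fieldType) (n : nat).
Local Notation P := {mpoly K[n]}.

Lemma pihomog_partition k (f : P) : (msize f <= k)%N ->
  f = \sum_(d < k) pihomog mdeg d f.
Proof. exact: pihomog_partitionE. Qed.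

Lemma pihomog_small d (f : P) : (msize f <= d)%N -> pihomog mdeg d f = 0.
Proof.
move=> h; rewrite (pihomogwE _ _ h); apply: big1 => m /eqP md.
by have := bmdeg m; rewrite md ltnn.
Qed.

Lemma pihomog_homogM d e (f g : P) : f \is e.-homog ->
  pihomog mdeg d (f * g) = if (e <= d)%N then f * pihomog mdeg (d - e) g else 0.
Proof.
move=> hf; have [k kg kd] : exists2 k, (msize g <= k)%N & (d < k)%N.
  by exists (msize g + d.+1)%N; [exact: leq_addr | exact: leq_addl].
rewrite {1}(pihomog_partition kg) mulr_sumr linear_sum /=.
have fgi (i : 'I_k) : f * pihomog mdeg i g \is (e + i).-homog.
  by apply: dhomogM => //; apply: pihomogP.
case: leqP => [ed|de].
  have dk : (d - e < k)%N by apply: leq_ltn_trans kd; apply: leq_subr.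
  rewrite (bigD1 (Ordinal dk)) //= pihomog_dE; last first.
    by have := fgi (Ordinal dk); rewrite /= subnKC.
  rewrite big1 ?addr0 // => i ni; apply: (@pihomog_ne0 _ _ _ (e + i)) => //.
  apply: contra ni => /eqP eid; apply/eqP/val_inj => /=.
  by rewrite -eid addKn.
apply: big1 => i _; apply: (@pihomog_ne0 _ _ _ (e + i)) => //.
by rewrite neq_ltn (leq_trans de) ?leq_addr ?orbT.
Qed.

Lemma pihomogM d (f g : P) :
  pihomog mdeg d (f * g) =
  \sum_(i < d.+1) pihomog mdeg i f * pihomog mdeg (d - i) g.
Proof.
have [k kg kd] : exists2 k, (msize f <= k)%N & (d < k)%N.
  by exists (msize f + d.+1)%N; [exact: leq_addr | exact: leq_addl].
rewrite {1}(pihomog_partition kg) mulr_suml linear_sum /=.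
under eq_bigr => i _ do rewrite (pihomog_homogM _ _ (pihomogP mdeg i f)).
rewrite -big_mkcond /= (big_ord_widen k
  (fun i => pihomog mdeg i f * pihomog mdeg (d - i) g) kd).
by apply: eq_bigl => i; rewrite ltnS.
Qed.

Record is_ideal (I : set P) : Prop := IsIdeal {
  ideal0 : I 0;
  idealD : forall f g, I f -> I g -> I (f + g);
  idealM : forall h f, I f -> I (h * f)
}.

Section Ideal.
Variable I : set P.
Hypothesis idI : is_ideal I.

Lemma idealMr h f : I f -> I (f * h).
Proof. by rewrite mulrC; apply: idealM. Qed.

Lemma idealN f : I f -> I (- f).
Proof. by rewrite -mulN1r; apply: idealM. Qed.

Lemma idealB f g : I f -> I g -> I (f - g).
Proof. by move=> If Ig; apply: idealD => //; apply: idealN. Qed.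

Lemma idealZ (c : K) f : I f -> I (c *: f).
Proof. by rewrite -mul_mpolyC; apply: idealM. Qed.

Lemma ideal_sum (T : Type) (r : seq T) (Q : pred T) (F : T -> P) :
  (forall t, Q t -> I (F t)) -> I (\sum_(t <- r | Q t) F t).
Proof. by move=> IF; apply: big_ind => //; [apply: ideal0 | apply: idealD]. Qed.

Lemma ideal_subspace : subspace I.
Proof.
by split=> [|c u v Iu Iv]; [exact: ideal0|apply: idealD => //; apply: idealZ].
Qed.

Lemma ideal_pihomog f : (forall d, I (pihomog mdeg d f)) -> I f.
Proof.
by move=> h; rewrite (pihomog_partition (leqnn (msize f))); apply: ideal_sum.
Qed.

(** Every monomial of positive degree is a variable times a monomial of degree one less. *)
Lemma ideal_homog N : (forall f, f \is N.-homog -> I f) ->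
  forall i f, (N <= i)%N -> f \is i.-homog -> I f.
Proof.
move=> IN; elim=> [|i IH] f.
  by rewrite leqn0 => /eqP N0; move: IN; rewrite N0; apply.
rewrite leq_eqVlt => /predU1P [<-|]; first exact: IN.
rewrite ltnS => Ni /dhomogP hf; rewrite (mpolyE f) big_seq.
apply: ideal_sum => m /hf /= mi; apply: idealZ.
have [k mk] : exists k, (0 < m k)%N.
  apply: contrapT => nk; move: mi; rewrite mdegE big1 // => k _.
  by apply/eqP; rewrite -leqn0 leqNgt; apply/negP => mk; apply: nk; exists k.
have Um : (U_(k) <= m)%MM.
  by apply/mnm_lepP => l; rewrite mnm1E; case: eqP => // <-.
rewrite -(submK Um) mpolyXD; apply: idealMr; apply: IH => //.
rewrite dhomogX /= -(eqn_add2r (mdeg U_(k))) -mdegD submK // mi.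
by rewrite mdeg1 addn1.
Qed.

End Ideal.

(** Pigeonhole: a monomial of degree larger than the sum of the M_i has some exponent at least M_k,
    hence is divisible by X_k^(M_k). *)
Lemma dhomog_sub_ideal (J : set P) : is_ideal J ->
  (forall i : 'I_n, exists N, J ('X_i ^+ N)) ->
  exists N, forall f, f \is N.-homog -> J f.
Proof.
move=> idJ /choice [M JM]; exists (\sum_i M i).+1 => f /dhomogP hf.
rewrite (mpolyE f) big_seq; apply: ideal_sum => // m /hf /= mi; apply: idealZ => //.
have [k mk] : exists k, (M k <= m k)%N.
  apply: contrapT => nk; move: mi => /eqP; rewrite mdegE.
  apply/negP; rewrite neq_ltn ltnS; apply/orP; left; apply: leq_sum => k _.
  by apply: ltnW; rewrite ltnNge; apply/negP => mk; apply: nk; exists k.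
have Um : (U_(k) *+ M k <= m)%MM.
  apply/mnm_lepP => l; rewrite mulmnE mnm1E; case: eqP => [<-|]; first by rewrite mul1n.
  by rewrite mul0n.
by rewrite -(submK Um) mpolyXD -mpolyXn; apply: idealM.
Qed.

(* An ideal maximal among those avoiding the powers of a is prime.            *)
Lemma exists_prime_avoiding (J : set P) (a : P) : is_ideal J ->
  (forall N, ~ J (a ^+ N)) ->
  exists Q, [/\ is_ideal Q, J `<=` Q, ~ Q a &
    forall f g, Q (f * g) -> Q f \/ Q g].
Proof.
move=> idJ Ja.
pose good (Q : set P) := is_ideal Q /\ forall N, ~ Q (a ^+ N).
(* Zorn is applied to sets A whose union with J is good, so that the empty chain is covered by J
   itself. *)
have [F FG totF|A [[idQ Qa] maxA]] := @Zorn_bigcup P [set A | good (J `|` A)].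
  have [->|/set0P [A0 FA0]] := eqVneq F set0.
    by rewrite /= bigcup_set0 setU0.
  have inF f : (J `|` \bigcup_(A in F) A) f -> exists2 A, F A & (J `|` A) f.
    by case=> [Jf|[A FA Af]]; [exists A0 => //; left | exists A => //; right].
  have toF f A : F A -> (J `|` A) f -> (J `|` \bigcup_(A in F) A) f.
    by move=> FA [Jf|Af]; [left | right; exists A].
  split; first split.
  - by left; apply: ideal0.
  - move=> f g /inF [A FA Af] /inF [B FB Bg].
    have [AB|BA] := totF _ _ FA FB.
      apply: (toF _ B) => //; apply: (idealD (FG _ FB).1) => //.
      by case: Af => [?|/AB ?]; [left | right].
    apply: (toF _ A) => //; apply: (idealD (FG _ FA).1) => //.
    by case: Bg => [?|/BA ?]; [left | right].
  - by move=> h f /inF [A FA Af]; apply: (toF _ A) => //; apply: (idealM (FG _ FA).1).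
  - by move=> N /inF [A FA]; apply: (FG _ FA).2.
exists (J `|` A); split=> //.
  by have := Qa 1%N; rewrite expr1.
move=> f g Qfg.
(* By maximality, the ideal B generated by Q and an element h outside Q contains a power of a. *)
have extend h : ~ (J `|` A) h -> exists N q r, (J `|` A) q /\ a ^+ N = q + r * h.
  move=> Qh; pose B := [set u | exists q r, (J `|` A) q /\ u = q + r * h].
  have AB : J `|` A `<=` B by move=> q Qq; exists q, 0; rewrite mul0r addr0.
  have JB : J `|` B = B by apply/setUidPr => u Ju; apply: AB; left.
  apply: contrapT => nN; apply: (maxA B).
    split; first by move=> u Au; apply: AB; right.
    move=> sBA; apply: Qh; right; apply: sBA; exists 0, 1.
    by rewrite mul1r add0r; split=> //; apply: ideal0.
  rewrite /= JB; split; last first.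
    by move=> N [q [r [Qq e]]]; apply: nN; exists N, q, r.
  split; first by apply: AB; apply: ideal0.
    move=> u v [q [r [Qq ->]]] [q' [r' [Qq' ->]]].
    exists (q + q'), (r + r'); split; first exact: idealD.
    by ring.
  move=> t u [q [r [Qq ->]]]; exists (t * q), (t * r); split; first exact: idealM.
  by ring.
have [?|nf] := pselect ((J `|` A) f); first by left.
have [?|ng] := pselect ((J `|` A) g); first by right.
have [N [q [r [Qq eN]]]] := extend _ nf; have [M [q' [r' [Qq' eM]]]] := extend _ ng.
case: (Qa (N + M)%N); rewrite exprD eN eM.
rewrite (_ : _ * _ = (q' + r' * g) * q + r * f * q' + r * r' * (f * g));
  last by ring.
by apply: idealD => //; [apply: idealD => //|]; apply: idealM.
Qed.

End Polynomials.

Section HomogeneousPrimes.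
Variables (K : fieldType) (n : nat).
Local Notation P := {mpoly K[n.+1]}.

Lemma homogeneous_is_ideal (I : set P) : homogeneous_ideal I -> is_ideal I.
Proof. by case. Qed.

Lemma homogeneousP (I : set P) f :
  homogeneous_ideal I -> I f <-> forall d, I (pihomog mdeg d f).
Proof.
move=> hI; split; first by case: hI => _ _ _ h If d; apply: h.
exact: (ideal_pihomog (homogeneous_is_ideal hI)).
Qed.

Definition homogeneous_core (Q : set P) : set P :=
  [set f | forall d, Q (pihomog mdeg d f)].

Section Core.
Variable Q : set P.
Hypothesis idQ : is_ideal Q.

Lemma homogeneous_coreP : homogeneous_ideal (homogeneous_core Q).
Proof.
split=> [d|f g Qf Qg d|h f Qf d|f i Qf d].
- by rewrite pihomog0; apply: ideal0.
- by rewrite pihomogD; apply: idealD.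
- by rewrite pihomogM; apply: ideal_sum => // i _; apply: idealM.
- have [->|ne] := eqVneq i d; first by rewrite pihomog_id.
  by rewrite (pihomog_ne0 ne (pihomogP _ _ _)); apply: ideal0.
Qed.

(* The product of the lowest components of f and g outside Q is, modulo Q, a  *)
(* component of f * g.                                                        *)
Lemma homogeneous_core_prime :
  (forall f g, Q (f * g) -> Q f \/ Q g) ->
  forall f g, homogeneous_core Q (f * g) ->
    homogeneous_core Q f \/ homogeneous_core Q g.
Proof.
move=> prQ f g Qfg; apply: contrapT => /not_orP [nf ng].
have low h : ~ homogeneous_core Q h ->
    exists a, ~ Q (pihomog mdeg a h) /\ forall i, (i < a)%N -> Q (pihomog mdeg i h).
  move=> /existsNP nh.
  have exh : exists a, `[< ~ Q (pihomog mdeg a h) >].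
    by case: nh => a na; exists a; apply/asboolP.
  case: (ex_minnP exh) => a /asboolP na mina; exists a; split=> // i ia.
  apply: contrapT => ni; suff : (a <= i)%N by rewrite leqNgt ia.
  by apply: mina; apply/asboolP.
have [a [na la]] := low _ nf; have [b [nb lb]] := low _ ng.
suff : Q (pihomog mdeg a f * pihomog mdeg b g) by move=> /prQ [].
have ab : (a < (a + b).+1)%N by rewrite ltnS leq_addr.
have := Qfg (a + b)%N; rewrite pihomogM (bigD1 (Ordinal ab)) //= addKn.
set S := (X in _ + X) => QS.
suff QS' : Q S by have := idealB idQ QS QS'; rewrite addrK.
apply: ideal_sum => // i ni; have [ia|ai|ia] := ltngtP i a.
- by apply: idealMr => //; apply: la.
- apply: idealM => //; apply: lb; rewrite ltn_subLR ?ltn_add2r //.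
  by rewrite -ltnS.
- by move: ni; rewrite -val_eqE /= ia eqxx.
Qed.

End Core.

(** By [dhomog_sub_ideal] some X_i has no power in J. The homogeneous core of a prime containing J
    and avoiding X_i is the required point, relevant because of X_i. *)
Lemma exists_point_above (J : set P) : homogeneous_ideal J ->
  (forall N, exists2 f, f \is N.-homog & ~ J f) ->
  exists x : proj_point K n, J `<=` prime_ideal x.
Proof.
move=> hJ nJ; have idJ := homogeneous_is_ideal hJ.
have [i Ji] : exists i : 'I_n.+1, forall N, ~ J ('X_i ^+ N).
  apply: contrapT => nX.
  have [|N JN] := dhomog_sub_ideal idJ.
    move=> i; apply: contrapT => nN; apply: nX; exists i => N JN.
    by apply: nN; exists N.
  by have [f /JN] := nJ N.
have [Q [idQ JQ Qi prQ]] := exists_prime_avoiding idJ Ji.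
have ni : ~ homogeneous_core Q 'X_i.
  by move=> /(_ 1%N); rewrite pihomog_dE // dhomogX /= mdeg1.
exists (ProjPoint (homogeneous_coreP idQ) (ex_intro _ i ni)
  (homogeneous_core_prime idQ prQ)) => f Jf d /=.
by apply: JQ; case: hJ => _ _ _; apply.
Qed.

End HomogeneousPrimes.

(** * Germs *)

Section LocalOperations.
Variables (K : fieldType) (n : nat) (X : proj_scheme K n) (x : proj_point K n).
Local Notation O := (local_ring X x).
Implicit Types u v : frac x.

Lemma local_piD u v : (\pi_O u : O) + (\pi_O v : O) = \pi_O (addf u v).
Proof. by rewrite pi_add. Qed.
Lemma local_piM u v : (\pi_O u : O) * (\pi_O v : O) = \pi_O (mulf u v).
Proof. by rewrite pi_mul. Qed.
Lemma local_piZ k u : k *: (\pi_O u : O) = \pi_O (scalef k u).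
Proof. by rewrite pi_scale. Qed.

End LocalOperations.

Section Restrict.
Variables (K : fieldType) (n : nat) (X Y : proj_scheme K n) (x : proj_point K n).
Hypothesis YX : subscheme Y X.

Lemma scheme_ideal (Z : proj_scheme K n) : is_ideal (vanishing_ideal Z).
Proof. exact/homogeneous_is_ideal/vanishing_ideal_homogeneous. Qed.

Lemma restrict_pi (u : frac x) :
  restrict Y (\pi_(local_ring X x) u) = \pi_(local_ring Y x) u.
Proof.
apply/local_ringP.
have /local_ringP [c [d [hc Ic]]] :
  \pi_(local_ring X x) (repr (\pi_(local_ring X x) u)) = \pi u by rewrite reprK.
by exists c, d; split=> //; apply: YX.
Qed.

Lemma restrict_linear : linear (@restrict K n X Y x).
Proof.
move=> k; elim/quotW=> u; elim/quotW=> v.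
by rewrite local_piZ local_piD !restrict_pi local_piZ local_piD.
Qed.

Definition restrict_map : {linear local_ring X x -> local_ring Y x} :=
  HB.pack (@restrict K n X Y x)
    (GRing.isLinear.Build K (local_ring X x) (local_ring Y x) *:%R
       (@restrict K n X Y x) restrict_linear).

Lemma restrict_surj v : exists u, @restrict K n X Y x u = v.
Proof. by elim/quotW: v => v; exists (\pi v); rewrite restrict_pi. Qed.

Lemma local_ring_eq0 (u : frac x) : \pi_(local_ring X x) u = 0 <->
  exists c d, denom x d c /\ vanishing_ideal X (c * u.1).
Proof.
have v01 := @val_Frac _ _ x 0 0 1 (dhomog0 _ _ _) (denom1 x).
split=> [/local_ringP|[c [d [hc Ic]]]].
  by rewrite v01 /= mulr1 mul0r subr0.
apply/local_ringP; exists c, d; split=> //.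
by rewrite v01 /= mulr1 mul0r subr0.
Qed.

Lemma local_scaleAl (k : K) (u v : local_ring X x) : (k *: u) * v = k *: (u * v).
Proof.
elim/quotW: u => u; elim/quotW: v => v.
rewrite local_piZ !local_piM local_piZ; apply: pi_eq.
by rewrite !fracE /= -!mul_mpolyC; ring.
Qed.

End Restrict.

Section Germs.
Variables (K : fieldType) (n : nat) (X : proj_scheme K n) (x : pt_of X).
Local Notation P := {mpoly K[n.+1]}.
Local Notation X0 := ('X_(ord0 : 'I_n.+1) : P).
Local Notation I := (vanishing_ideal X).
Local Notation O := (stalk x).
Hypothesis nX0 : ~ prime_ideal x X0.

Let idI : is_ideal I := scheme_ideal X.
Let idp : is_ideal (prime_ideal x) := homogeneous_is_ideal (prime_homogeneous x).

Lemma stalk_scaleAl (k : K) (u v : O) : (k *: u) * v = k *: (u * v).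
Proof. exact: local_scaleAl. Qed.

Lemma dhomogX0 i : X0 ^+ i \is i.-homog.
Proof.
by rewrite -[i in i.-homog]mul1n; apply: dhomogMn; rewrite dhomogX /= mdeg1.
Qed.

Lemma denomX0 i : denom x i (X0 ^+ i).
Proof.
split; first exact: dhomogX0.
elim: i => [|i IH]; first exact: prime1.
by rewrite exprS => /prime_mul [].
Qed.

Lemma val_germ i (f : P) : f \is i.-homog ->
  fval (Frac x f (X0 ^+ i)) = (f, X0 ^+ i).
Proof. by move=> hf; rewrite (val_Frac hf (denomX0 i)). Qed.

Lemma germ_eq0 i f : f \is i.-homog ->
  germ x i f = 0 <-> exists c d, denom x d c /\ I (c * f).
Proof.
move=> hf; have := @local_ring_eq0 _ _ X x (Frac x f (X0 ^+ i)).
by rewrite val_germ.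
Qed.

Lemma germ_ideal i f : f \is i.-homog -> I f -> germ x i f = 0.
Proof.
move=> hf If; apply/(germ_eq0 hf); exists 1, 0%N; split; first exact: denom1.
by rewrite mul1r.
Qed.

Lemma germ0 i : germ x i 0 = 0.
Proof. by apply: germ_ideal; [exact: dhomog0 | exact: ideal0]. Qed.

Lemma germP i (k : K) f g : f \is i.-homog -> g \is i.-homog ->
  germ x i (k *: f + g) = k *: germ x i f + germ x i g.
Proof.
move=> hf hg; rewrite /germ local_piZ local_piD; apply: pi_eq.
have hkf : k *: f + g \is i.-homog by apply: dhomogD => //; apply: dhomogZ.
by rewrite !fracE !val_germ //= -!mul_mpolyC; ring.
Qed.

Lemma germD i f g : f \is i.-homog -> g \is i.-homog ->
  germ x i (f + g) = germ x i f + germ x i g.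
Proof. by move=> hf hg; rewrite -[f]scale1r germP // !scale1r. Qed.

Lemma germZ i (k : K) f : f \is i.-homog -> germ x i (k *: f) = k *: germ x i f.
Proof.
by move=> hf; rewrite -[k *: f]addr0 germP ?germ0 ?addr0 //; apply: dhomog0.
Qed.

Lemma germB i f g : f \is i.-homog -> g \is i.-homog ->
  germ x i (f - g) = germ x i f - germ x i g.
Proof.
by move=> hf hg; rewrite -!scaleN1r germD ?germZ //; apply: dhomogZ.
Qed.

Lemma germ_sum i (T : Type) (r : seq T) (c : T -> K) (F : T -> P) :
  (forall t, F t \is i.-homog) ->
  germ x i (\sum_(t <- r) c t *: F t) = \sum_(t <- r) c t *: germ x i (F t).
Proof.
move=> hF; elim: r => [|t r IH]; first by rewrite !big_nil germ0.
rewrite !big_cons germP // ?IH //.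
by apply: rpred_sum => k _; apply: dhomogZ.
Qed.

Lemma germM i j f g : f \is i.-homog -> g \is j.-homog ->
  germ x (i + j) (f * g) = germ x i f * germ x j g.
Proof.
move=> hf hg; rewrite /germ local_piM; apply: pi_eq.
by rewrite !fracE !val_germ //= ?exprD; [ring | exact: dhomogM].
Qed.

Lemma germX0 i : germ x i (X0 ^+ i) = 1.
Proof.
apply: pi_eq; rewrite val_germ; last exact: dhomogX0.
by rewrite (val_Frac (dhomog1 _ _) (denom1 x)) /= mulr1 mul1r.
Qed.

Lemma germ_shift k i f : f \is i.-homog -> germ x (k + i) (X0 ^+ k * f) = germ x i f.
Proof. by move=> hf; rewrite germM ?germX0 ?mul1r //; apply: dhomogX0. Qed.

Lemma germ_inv i f : f \is i.-homog -> ~ prime_ideal x f ->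
  exists v, germ x i f * v = 1.
Proof.
move=> hf nf; exists (\pi_(local_ring X x) (Frac x (X0 ^+ i) f)).
rewrite /germ local_piM; apply: pi_eq; rewrite !fracE val_germ //.
rewrite (val_Frac (dhomogX0 i) (conj hf nf)) (val_Frac (dhomog1 _ _) (denom1 x)) /=.
by ring.
Qed.

Lemma stalk_fraction (u : O) : exists i a b,
  [/\ a \is i.-homog, denom x i b & u * germ x i b = germ x i a].
Proof.
elim/quotW: u => u; have [d [ha hb]] := fracP u.
exists d, u.1, u.2; split=> //; rewrite /germ local_piM; apply: pi_eq.
by rewrite !fracE !val_germ //=; [ring | case: hb].
Qed.

Lemma maximal_idealP (v : frac x) :
  @maximal_ideal _ _ X x (\pi_(local_ring X x) v) <-> prime_ideal x v.1.
Proof.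
split=> [[w pw /local_ringP [c [d [[_ nc] /(@pt_of_sub _ _ X x)]]]]|pv]; last by exists v.
case/prime_mul=> // h; have [e [_ [_ nw]]] := fracP w.
have : prime_ideal x (v.1 * w.2).
  by rewrite -[_ * _](subrK (w.1 * v.2)); apply: idealD => //; apply: idealMr.
by case/prime_mul.
Qed.

Lemma maximal_germ i f : f \is i.-homog ->
  @maximal_ideal _ _ X x (germ x i f) <-> prime_ideal x f.
Proof. by move=> hf; rewrite /germ maximal_idealP val_germ. Qed.

Lemma maximal_ideal0 : @maximal_ideal _ _ X x 0.
Proof. by rewrite -(germ0 0); apply/maximal_germ; [exact: dhomog0|exact: ideal0]. Qed.

Lemma maximal_idealD (u v : O) :
  maximal_ideal u -> maximal_ideal v -> maximal_ideal (u + v).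
Proof.
move=> [a pa ->] [b pb ->]; rewrite local_piD; apply/maximal_idealP.
by rewrite fracE /=; apply: idealD => //; apply: idealMr.
Qed.

Lemma maximal_idealM (u v : O) : maximal_ideal v -> maximal_ideal (u * v).
Proof.
move=> [b pb ->]; elim/quotW: u => u; rewrite local_piM; apply/maximal_idealP.
by rewrite fracE /=; apply: idealM.
Qed.

Lemma maximal_idealZ (k : K) (v : O) : maximal_ideal v -> maximal_ideal (k *: v).
Proof. by move=> mv; rewrite -[v]mul1r -stalk_scaleAl; apply: maximal_idealM. Qed.

Lemma maximal_ideal_subspace : subspace (@maximal_ideal _ _ X x).
Proof.
split=> [|k u v mu mv]; first exact: maximal_ideal0.
by apply: maximal_idealD => //; apply: maximal_idealZ.
Qed.

Lemma maximal_ideal1 : ~ @maximal_ideal _ _ X x 1.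
Proof.
rewrite -(germX0 0) => /maximal_germ; rewrite expr0 => /(_ (dhomog1 _ _)).
exact: prime1.
Qed.

Lemma stalk_inv (u : O) : ~ maximal_ideal u -> exists v, u * v = 1.
Proof.
move=> nu; have [i [a [b [ha [hb nb] e]]]] := stalk_fraction u.
have na : ~ prime_ideal x a.
  move=> /(maximal_germ ha) ma; apply: nu.
  have [v bv] := germ_inv hb nb.
  by rewrite -[u]mulr1 -bv mulrA e mulrC; apply: maximal_idealM.
have [w aw] := germ_inv ha na; exists (germ x i b * w).
by rewrite mulrA e.
Qed.

Lemma stalk_inv1 (u v : O) : maximal_ideal u -> exists w, (1 + u * v) * w = 1.
Proof.
move=> mu; apply: stalk_inv => m1; apply: maximal_ideal1.
rewrite -[1](addrK (u * v)) -mulNr [- u * v]mulrC; apply: maximal_idealD => //.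
by apply: maximal_idealM; rewrite -scaleN1r; apply: maximal_idealZ.
Qed.

End Germs.

(** * Stalks of a zero-dimensional scheme *)

Lemma pt_of_eq (K : fieldType) (n : nat) (X : proj_scheme K n) (x y : pt_of X) :
  prime_ideal x = prime_ideal y -> x = y.
Proof.
case: x => [[I1 h1 r1 m1] s1]; case: y => [[I2 h2 r2 m2] s2] /= e.
case: _ / e in h2 r2 m2 s2 *.
rewrite (Prop_irrelevance h2 h1) (Prop_irrelevance r2 r1) in s2 *.
rewrite (Prop_irrelevance m2 m1) in s2 *.
by rewrite (Prop_irrelevance s2 s1).
Qed.

Lemma dhomog_spans (K : fieldType) (n i : nat) (f : {mpoly K[n]}) :
  f \is i.-homog ->
  f = \sum_(m : 'X_{1..n < i.+1}) f@_m *: pihomog mdeg i 'X_[m].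
Proof.
move=> hf; rewrite -{1}(pihomog_dE hf).
have mf : (msize f <= i.+1)%N.
  by rewrite mmeasureE; apply/bigmax_leqP_seq => m /(dhomog_mf hf) /= ->.
rewrite {1}(mpolywE mf) linear_sum; apply: eq_bigr => m _.
by rewrite linearZ.
Qed.

Section ZeroDimensional.
Variables (K : fieldType) (n : nat) (X : proj_scheme K n).
Variables (s : nat) (p : 'I_s -> pt_of X).
Local Notation P := {mpoly K[n.+1]}.
Local Notation X0 := ('X_(ord0 : 'I_n.+1) : P).
Local Notation I := (vanishing_ideal X).
Local Notation O j := (stalk (p j)).

Hypothesis zdX : zero_dimensional X.
Hypothesis enumX : enumerates_Supp p.
Hypothesis nX0 : forall j, ~ prime_ideal (p j) X0.

Let idI : is_ideal I := scheme_ideal X.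
Let hI : homogeneous_ideal I := vanishing_ideal_homogeneous X.

(** In dimension zero every point of X is closed, hence enumerated by p. *)
Lemma sub_point (J : set P) (x : proj_point K n) :
  I `<=` J -> J `<=` prime_ideal x -> exists j, J `<=` prime_ideal (p j).
Proof.
move=> IJ Jx; pose y := PtOf (subset_trans IJ Jx).
have [|j pj] := (enumX.2 y).1; last by exists j; rewrite pj.
by move=> z yz; rewrite (zdX.2 y z yz).
Qed.

Lemma irrelevant_ideal (J : set P) : homogeneous_ideal J -> I `<=` J ->
  (forall j, exists2 f, J f & ~ prime_ideal (p j) f) ->
  exists N, forall f, f \is N.-homog -> J f.
Proof.
move=> hJ IJ nJ; apply: contrapT => nN.
have [|x Jx] := exists_point_above hJ.
  move=> N; apply: contrapT => h; apply: nN; exists N => f hf.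
  by apply: contrapT => nf; apply: h; exists f.
have [j Jj] := sub_point IJ Jx.
by have [f /Jj] := nJ j.
Qed.

(** A vanishing germ at p_j provides an element of (I : f) outside p_j, so (I : f) contains all
    forms of some degree and saturation applies. *)
Lemma germs_inj i f : f \is i.-homog -> (forall j, germ (p j) i f = 0) -> I f.
Proof.
move=> hf f0; pose J : set P := [set g | I (f * g)].
have hJ : homogeneous_ideal J.
  split=> [|g h Jg Jh|h g Jg|g d Jg]; rewrite /J /=.
  - by rewrite mulr0; apply: ideal0.
  - by rewrite mulrDr; apply: idealD.
  - by rewrite mulrCA; apply: idealM.
  - have [_ _ _ /(_ _ (i + d)%N Jg)] := hI.
    by rewrite (pihomog_homogM _ _ hf) leq_addr addKn.
have [||N JN] := irrelevant_ideal hJ.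
- by move=> g Ig; apply: idealM.
- move=> j; have [c [d [[_ nc] Ic]]] := (germ_eq0 (@nX0 j) hf).1 (f0 j).
  by exists c; rewrite // /J /= mulrC.
apply: vanishing_ideal_saturated; exists N => g /JN.
by rewrite mulrC.
Qed.

Lemma X0_generates : exists N, forall i f, (N <= i)%N -> f \is i.+1.-homog ->
  exists2 h, h \is i.-homog & I (f - X0 * h).
Proof.
pose J : set P := [set f | exists g, I (f - X0 * g)].
have hX0 : X0 \is 1.-homog by rewrite -[X0]expr1; apply: dhomogX0.
have hJ : homogeneous_ideal J.
  split.
  - by exists 0; rewrite mulr0 subr0; apply: ideal0.
  - move=> f g [h If] [k Ig]; exists (h + k).
    by rewrite mulrDr opprD addrACA; apply: (idealD idI).
  - move=> h f [g If]; exists (h * g).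
    by rewrite mulrCA -mulrBr; apply: idealM.
  - move=> f d [g If]; have [_ _ _ /(_ _ d If)] := hI.
    rewrite pihomogB (pihomog_homogM _ _ hX0); case: leqP => _ h.
      by exists 0; rewrite mulr0.
    by exists (pihomog mdeg (d - 1) g).
have [||N JN] := irrelevant_ideal hJ.
- by move=> f If; exists 0; rewrite mulr0 subr0.
- by move=> j; exists X0 => //; exists 1; rewrite mulr1 subrr; apply: ideal0.
exists N => i f Ni hf.
have [g Ig] : J f.
  exact: (ideal_homog (homogeneous_is_ideal hJ) JN (leqW Ni) hf).
exists (pihomog mdeg i g); first exact: pihomogP.
have [_ _ _ /(_ _ i.+1 Ig)] := hI.
by rewrite pihomogB (pihomog_dE hf) (pihomog_homogM _ _ hX0) subn1.
Qed.

(** Multiplication by X_0 leaves germs unchanged. Forms of degree below N are multiplied up to N;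
    forms of higher degree are, modulo I, divisible by X_0 and can be brought down. *)
Lemma germs_stable : exists N, forall i f, f \is i.-homog ->
  exists2 h, h \is N.-homog & forall j, germ (p j) N h = germ (p j) i f.
Proof.
have [N gN] := X0_generates; exists N => i.
have [iN|/ltnW] := leqP i N.
  move=> f hf; exists (X0 ^+ (N - i) * f).
    by rewrite -(subnK iN) addnK; apply: dhomogM => //; apply: dhomogX0.
  by move=> j; rewrite -{1}(subnK iN) germ_shift.
elim: i => [|i IH]; first by rewrite leqn0 => /eqP -> f hf; exists f.
rewrite leq_eqVlt => /predU1P [<- f hf|]; first by exists f.
rewrite ltnS => Ni f hf; have [h hh Ih] := gN _ _ Ni hf.
have [h' hh' e] := IH Ni _ hh; exists h' => // j.
have hX : X0 * h \is (1 + i).-homog.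
  by apply: dhomogM => //; rewrite -[X0]expr1; apply: dhomogX0.
rewrite e -(germ_shift (@nX0 j) 1 hh) expr1.
apply/esym/eqP; rewrite -subr_eq0 -germB //; apply/eqP/germ_ideal => //.
exact: rpredB.
Qed.

Definition is_germ j (u : O j) : Prop :=
  exists i, exists2 f, f \is i.-homog & germ (p j) i f = u.

Section OnePoint.
Variable j : 'I_s.
Local Notation is_germ := (@is_germ j).

Lemma is_germ1 : is_germ 1.
Proof. by exists 0%N, 1; [exact: dhomog1 | rewrite -(germX0 (@nX0 j) 0) expr0]. Qed.

Lemma is_germD u v : is_germ u -> is_germ v -> is_germ (u + v).
Proof.
move=> [i [f hf <-]] [k [g hg <-]].
exists (k + i)%N, (X0 ^+ k * f + X0 ^+ i * g).
  apply: dhomogD; first by apply: dhomogM => //; apply: dhomogX0.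
  by rewrite addnC; apply: dhomogM => //; apply: dhomogX0.
rewrite germD //; first by rewrite (addnC k i) germ_shift // addnC germ_shift.
  by apply: dhomogM => //; apply: dhomogX0.
by rewrite addnC; apply: dhomogM => //; apply: dhomogX0.
Qed.

Lemma is_germM u v : is_germ u -> is_germ v -> is_germ (u * v).
Proof.
move=> [i [f hf <-]] [k [g hg <-]]; exists (i + k)%N, (f * g).
  exact: dhomogM.
by rewrite germM.
Qed.

Lemma is_germZ (c : K) u : is_germ u -> is_germ (c *: u).
Proof.
by move=> [i [f hf <-]]; exists i, (c *: f); [exact: dhomogZ | rewrite germZ].
Qed.

Lemma is_germ0 : is_germ 0.
Proof. by have := is_germZ 0 is_germ1; rewrite scale0r. Qed.

Lemma is_germX u k : is_germ u -> is_germ (u ^+ k).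
Proof.
move=> gu; elim: k => [|k IH]; first by rewrite expr0; apply: is_germ1.
by rewrite exprS; apply: is_germM.
Qed.

Lemma germ_spans : exists m (e : 'I_m -> O j), spans is_germ [set 0] e.
Proof.
have [N stN] := germs_stable; pose T := [the finType of 'X_{1..n.+1 < N.+1}].
pose e (t : T) := germ (p j) N (pihomog mdeg N 'X_[t]).
exists #|T|, (fun i => e (enum_val i)) => _ [i [f hf <-]].
have [h hh <-] := stN _ _ hf; exists (fun i => h@_(enum_val i : T)).
rewrite /= {1}(dhomog_spans hh) germ_sum //; last by move=> t; apply: pihomogP.
rewrite (reindex (fun i : 'I_#|T| => enum_val i)) ?subrr //.
exact/onW_bij/(@enum_val_bij T).
Qed.

(* The lowest nonzero coefficient of a polynomial relation for u can be       *)
(* normalized to 1.                                                           *)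
Lemma algebraic_relation m a (c : nat -> K) (u : O j) : is_germ u ->
  (exists2 k, (k <= m)%N & c k != 0) ->
  u ^+ a * (\sum_(k < m.+1) c k *: u ^+ k) = 0 ->
  exists l w, is_germ w /\ u ^+ l * (1 + u * w) = 0.
Proof.
move=> gu; elim: m a c => [|m IH] a c [k km ck].
  move: km ck; rewrite leqn0 => /eqP -> c0.
  rewrite big_ord_recl big_ord0 addr0 expr0 => /(congr1 ( *:%R (c 0)^-1)).
  rewrite scaler0 mulrC stalk_scaleAl scalerA mulVf // scale1r mul1r => ua.
  by exists a, 0; split; [exact: is_germ0 | rewrite mulr0 addr0 mulr1].
rewrite big_ord_recl expr0.
have -> : \sum_(i < m.+1) c (fintype.lift ord0 i) *: u ^+ (fintype.lift ord0 i) =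
    u * (\sum_(i < m.+1) c i.+1 *: u ^+ i).
  rewrite mulr_sumr; apply: eq_bigr => i _.
  by rewrite [in RHS]mulrC stalk_scaleAl -exprSr.
set S : O j := \sum_(i < _) _ => rel.
have [c0|c0] := eqVneq (c 0%N) 0.
  apply: (IH a.+1 (fun k => c k.+1)).
    by case: k km ck => [|k] km ck; [rewrite c0 eqxx in ck | exists k].
  by move: rel; rewrite /= c0 scale0r add0r mulrA -exprSr.
exists a, ((c 0%N)^-1 *: S); split.
  apply: is_germZ; rewrite /S; apply: (big_ind is_germ); first exact: is_germ0.
    exact: is_germD.
  by move=> i _; apply/is_germZ/is_germX.
have -> : 1 + u * ((c 0%N)^-1 *: S) = (c 0%N)^-1 *: (c 0%N *: (1 : O j) + u * S).
  by rewrite scalerDr scalerA mulVf // scale1r mulrC stalk_scaleAl mulrC.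
by rewrite mulrC stalk_scaleAl mulrC [X in _ *: X]rel scaler0.
Qed.

(** The germs lie in a finite-dimensional space, so powers of u are dependent. The normalized
    relation has two uses: if u is a unit, then -w is its inverse; if u lies in the maximal ideal,
    then 1 + u w is a unit and u is nilpotent. *)
Lemma germ_algebraic (u : O j) : is_germ u ->
  exists l w, is_germ w /\ u ^+ l * (1 + u * w) = 0.
Proof.
move=> gu; have [m [e spe]] := germ_spans.
have ndep : ~ independent [set 0] (fun k : 'I_m.+1 => u ^+ k).
  move=> ind; suff : (m.+1 <= m)%N by rewrite ltnn.
  apply: (independent_leq (@subspace_set0 _ _) ind (e := e)).
  by move=> _ [k _ <-]; apply/spe/is_germX.
have [c [c0 [k ck]]] : exists c : 'I_m.+1 -> K,
    \sum_k c k *: u ^+ k = 0 /\ exists k, c k != 0.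
  apply: contrapT => nc; apply: ndep => c c0 k; apply/eqP; apply: contrapT => /negP ck.
  by apply: nc; exists c; split=> //; exists k.
apply: (@algebraic_relation m 0 (fun k => c (inord k)) u gu).
  by exists k; rewrite ?inord_val // -ltnS.
by rewrite expr0 mul1r -[RHS]c0; apply: eq_bigr => i _; rewrite inord_val.
Qed.

(** Write u = a/b. The germ of b is a unit, so its inverse is again a germ by the relation of
    [germ_algebraic]. *)
Lemma stalk_germ (u : O j) : is_germ u.
Proof.
have [i [a [b [ha [hb nb] e]]]] := stalk_fraction (@nX0 j) u.
have [v bv] := germ_inv (@nX0 j) hb nb.
have gb : is_germ (germ (p j) i b) by exists i, b.
have [l [w [gw rel]]] := germ_algebraic gb.
have rel1 : 1 + germ (p j) i b * w = 0.
  have : (germ (p j) i b * v) ^+ l * (1 + germ (p j) i b * w) = 0.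
    by rewrite exprMn mulrAC rel mul0r.
  by rewrite bv expr1n mul1r.
suff -> : u = germ (p j) i a * (-1 *: w).
  by apply: is_germM; [exists i, a | apply: is_germZ].
rewrite -e -mulrA scaleN1r mulrN (_ : - _ = 1) ?mulr1 //.
by apply/esym/eqP; rewrite -subr_eq0 opprK rel1.
Qed.

Lemma maximal_nilpotent (u : O j) : maximal_ideal u -> exists l, u ^+ l = 0.
Proof.
move=> mu; have [l [w [_ rel]]] := germ_algebraic (stalk_germ u).
have [v wv] := stalk_inv1 (@nX0 j) w mu.
by exists l; rewrite -[LHS]mulr1 -wv mulrA rel mul0r.
Qed.

Lemma stalk_spans : exists m (e : 'I_m -> O j), spans setT [set 0] e.
Proof.
by have [m [e spe]] := germ_spans; exists m, e => u _; apply/spe/stalk_germ.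
Qed.

Lemma stalk_residue_basis (U W : set (O j)) : subspace W ->
  exists e : 'I_(quot_dim U W) -> O j, residue_basis U W e.
Proof.
move=> sW; have [m [e spe]] := stalk_spans; apply: (exists_residue_basis (e := e)) => //.
by move=> u _; have [c /= c0] := spe u Logic.I; exists c; rewrite c0; case: sW.
Qed.

End OnePoint.

End ZeroDimensional.

(** * Surjectivity of the germ map *)

Section Surjectivity.
Variables (K : fieldType) (n : nat) (X : proj_scheme K n).
Variables (s : nat) (p : 'I_s -> pt_of X).
Local Notation P := {mpoly K[n.+1]}.
Local Notation X0 := ('X_(ord0 : 'I_n.+1) : P).
Local Notation I := (vanishing_ideal X).
Local Notation O j := (stalk (p j)).

Hypothesis zdX : zero_dimensional X.
Hypothesis enumX : enumerates_Supp p.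
Hypothesis nX0 : forall j, ~ prime_ideal (p j) X0.

Let idI : is_ideal I := scheme_ideal X.

(** Distinct points have incomparable primes, so some homogeneous component lies in p_k but not in
    p_j. Its germ at p_k is nilpotent, and a power of it has germ 0 there. *)
Lemma separating_element j k : k != j ->
  exists i f, [/\ f \is i.-homog, ~ prime_ideal (p j) f & germ (p k) i f = 0].
Proof.
move=> kj.
have [f [pkf npf]] : exists f, prime_ideal (p k) f /\ ~ prime_ideal (p j) f.
  apply: contrapT => nf; move/eqP: kj; apply; apply: enumX.1.
  apply: pt_of_eq; apply: zdX.2 => f pkf; apply: contrapT => npf.
  by apply: nf; exists f.
have [d [pkd npd]] : exists d, prime_ideal (p k) (pihomog mdeg d f) /\
    ~ prime_ideal (p j) (pihomog mdeg d f).
  apply: contrapT => nd; apply: npf.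
  apply/(homogeneousP f (prime_homogeneous (p j))) => d.
  apply: contrapT => npd; apply: nd; exists d; split=> //.
  exact: ((homogeneousP f (prime_homogeneous (p k))).1 pkf).
have hd := pihomogP mdeg d f; set g := pihomog mdeg d f in hd pkd npd.
have [l gl] := maximal_nilpotent zdX enumX nX0 ((maximal_germ (@nX0 k) hd).2 pkd).
have hX l' : g ^+ l' \is (d * l').-homog by apply: dhomogMn.
exists (d * l)%N, (g ^+ l); split=> //.
  elim: l {gl} => [|l IH]; first exact: prime1.
  by rewrite exprS => /prime_mul [].
rewrite -gl; elim: l {gl} => [|l IH].
  by rewrite muln0 !expr0 -(germX0 (@nX0 k) 0) expr0.
by rewrite mulnS !exprS germM // IH.
Qed.

Lemma isolating_element j : exists i f, [/\ f \is i.-homog, ~ prime_ideal (p j) f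
  & forall k, k != j -> germ (p k) i f = 0].
Proof.
suff [i [f [hf nf f0]]] : exists i f, [/\ f \is i.-homog, ~ prime_ideal (p j) f
    & forall k, k \in enum 'I_s -> k != j -> germ (p k) i f = 0].
  by exists i, f; split=> // k; apply: f0; rewrite mem_enum.
elim: (enum 'I_s) => [|k r [i [f [hf nf f0]]]].
  by exists 0%N, 1; split=> //; [exact: dhomog1 | exact: prime1].
have [->|/separating_element [d [g [hg ng g0]]]] := eqVneq k j.
  exists i, f; split=> // l; rewrite inE => /predU1P [->|]; last exact: f0.
  by rewrite eqxx.
exists (d + i)%N, (g * f); split; first exact: dhomogM.
  by case/prime_mul.
move=> l; rewrite inE germM // => /predU1P [->|lr lj]; first by rewrite g0 mul0r.
by rewrite f0 // mulr0.
Qed.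

(** This is membership of (0, ..., a T_j^i, ..., 0) in R, stated by forms; see [R_image_single]. *)
Definition isolated i j (a : O j) : Prop :=
  exists2 f, f \is i.-homog &
    germ (p j) i f = a /\ forall k, k != j -> germ (p k) i f = 0.

Definition germs_onto i : Prop :=
  forall a : forall j, O j, exists2 f, f \is i.-homog &
    forall j, germ (p j) i f = a j.

Lemma isolatedM i k j (a b : O j) : isolated i a ->
  (exists2 f, f \is k.-homog & germ (p j) k f = b) ->
  isolated (i + k) (a * b).
Proof.
move=> [f hf [<- f0]] [g hg <-]; exists (f * g); first exact: dhomogM.
by split=> [|l lj]; rewrite germM // f0 // mul0r.
Qed.

Lemma isolated_leq i k j (a : O j) : (i <= k)%N -> isolated i a -> isolated k a.
Proof.
move=> ik ia; rewrite -[a]mulr1 -(subnKC ik); apply: isolatedM => //.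
by exists (X0 ^+ (k - i)); [exact: dhomogX0 | rewrite germX0].
Qed.

Lemma isolatedD i j (a b : O j) : isolated i a -> isolated i b -> isolated i (a + b).
Proof.
move=> [f hf [<- f0]] [g hg [<- g0]]; exists (f + g); first exact: dhomogD.
by split=> [|k kj]; rewrite germD // f0 // g0 // addr0.
Qed.

Lemma isolatedZ i j (c : K) (a : O j) : isolated i a -> isolated i (c *: a).
Proof.
move=> [f hf [<- f0]]; exists (c *: f); first exact: dhomogZ.
by split=> [|k kj]; rewrite germZ // f0 // scaler0.
Qed.

Lemma isolated0 i j : isolated i (0 : O j).
Proof. by exists 0; [exact: dhomog0 | split=> [|k kj]; rewrite germ0]. Qed.

Lemma isolated_subspace i j : subspace (@isolated i j).
Proof.
by split=> [|c u v iu iv]; [exact: isolated0|apply: isolatedD => //; apply: isolatedZ].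
Qed.

Lemma isolated_sum i (a : forall j, O j) : (forall j, isolated i (a j)) ->
  exists2 f, f \is i.-homog & forall j, germ (p j) i f = a j.
Proof.
move=> ia; pose f j := s2val (cid2 (ia j)).
have hf j : f j \is i.-homog := s2valP (cid2 (ia j)).
exists (\sum_j 1 *: f j); first by apply: rpred_sum => j _; apply: dhomogZ.
move=> j; rewrite germ_sum // (bigD1 j) //= scale1r.
have [-> _] := s2valP' (cid2 (ia j)).
rewrite big1 ?addr0 // => k kj; have [_ ->] := s2valP' (cid2 (ia k)).
  by rewrite scaler0.
by rewrite eq_sym.
Qed.

(** A form isolating p_j has an invertible germ there, so its product with a suitable form isolates
    any given a_j. [germs_stable] makes the degree independent of a. *)
Lemma germs_onto_large : exists N, forall i, (N <= i)%N -> germs_onto i.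
Proof.
have [N stN] := germs_stable zdX enumX nX0; exists N => i Ni a.
apply: isolated_sum => j; apply: (isolated_leq Ni).
have [d [g [hg ng g0]]] := isolating_element j.
have [v gv] := germ_inv (@nX0 j) hg ng.
have [k [f hf fE]] := stalk_germ zdX enumX nX0 (v * a j).
have ia : isolated (d + k) (a j).
  rewrite -[a j]mul1r -gv -mulrA; apply: isolatedM; last by exists f.
  by exists g.
have [h hh [ha h0]] := ia; have [h' hh' e] := stN _ _ hh.
by exists h' => //; split=> [|l lj]; rewrite e // h0.
Qed.

(** Taking germs identifies P_i modulo I with the product of the O_j; lifting bases of all the O_j
    yields a basis indexed by dependent pairs. *)
Lemma germs_onto_hilbert i : germs_onto i -> hilbert_function X i = degree p X.
Proof.
move=> onto; rewrite /hilbert_function /degree.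
pose D (j : 'I_s) := quot_dim [set: O j] [set 0].
have bO j : exists e : 'I_(D j) -> O j, residue_basis setT [set 0] e.
  exact: (stalk_residue_basis zdX enumX nX0 setT (@subspace_set0 _ _)).
pose e j : 'I_(D j) -> O j := sval (cid (bO j)).
have eP j : residue_basis setT [set 0] (e j) := svalP (cid (bO j)).
have iso j k : isolated i (e j k).
  have [f hf fa] := onto (dfwith (fun k => 0 : O k) (e j k)).
  exists f => //; split=> [|l lj]; rewrite fa; first by rewrite dfwith_in.
  by rewrite dfwith_out // eq_sym.
pose h j k := s2val (cid2 (iso j k)).
have hh j k : h j k \is i.-homog := s2valP (cid2 (iso j k)).
pose T : finType := {j : 'I_s & 'I_(D j)}.
have hsum (c : T -> K) : \sum_t c t *: h (tag t) (tagged t) \is i.-homog.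
  by apply: rpred_sum => t _; apply: dhomogZ.
have germ_h (c : T -> K) j : germ (p j) i (\sum_t c t *: h (tag t) (tagged t)) =
    \sum_k c (Tagged (fun j => 'I_(D j)) k) *: e j k.
  rewrite germ_sum //.
  pose F l (k : 'I_(D l)) := c (Tagged (fun j => 'I_(D j)) k) *: germ (p j) i (h l k).
  transitivity (\sum_l \sum_k F l k).
    rewrite (sig_big_dep xpredT (fun _ => xpredT) F).
    by apply: eq_bigr => -[l k] _.
  rewrite (bigD1 j) //= [X in _ + X]big1 ?addr0 => [|l lj].
    apply: eq_bigr => k _; rewrite /F.
    by have [-> _] := s2valP' (cid2 (iso j k)).
  apply: big1 => k _; rewrite /F; have [_ ->] := s2valP' (cid2 (iso l k)).
    by rewrite scaler0.
  by rewrite eq_sym.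
have bh : fin_basis [set f : P | f \is i.-homog] I (fun t : T => h (tag t) (tagged t)).
  split=> [t|f hf|c Ic [j k]]; first exact: hh.
    have fc j : exists c : 'I_(D j) -> K, germ (p j) i f = \sum_k c k *: e j k.
      have [_ sp _] := eP j; have [c /= c0] := sp (germ (p j) i f) Logic.I.
      by exists c; apply/eqP; rewrite -subr_eq0; apply/eqP.
    pose c (t : T) := sval (cid (fc (tag t))) (tagged t).
    exists c; apply: (germs_inj zdX enumX nX0 (rpredB hf (hsum c))).
    by move=> j; rewrite germB // germ_h (svalP (cid (fc j))) subrr.
  have [_ _ ind] := eP j; apply: (ind (fun k => c (Tagged (fun j => 'I_(D j)) k))).
  by rewrite /= -germ_h germ_ideal.
rewrite (quot_dim_fin_basis (ideal_subspace idI) bh) card_tagged.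
by rewrite sumnE big_map big_enum; apply: eq_bigr => j _; rewrite card_ord.
Qed.

(** Multiplication by X_0^N is injective modulo I from degree i to degree N + i. The dimensions
    agree, so it is onto, and surjectivity of germs descends from the large degree N + i. *)
Lemma hilbert_germs_onto i : hilbert_function X i = degree p X -> germs_onto i.
Proof.
move=> HFi a; have [N onto] := germs_onto_large.
have exb t : exists b : 'I_(hilbert_function X t) -> P,
    residue_basis [set f : P | f \is t.-homog] I b.
  pose T : finType := 'X_{1..n.+1 < t.+1}.
  apply: (exists_residue_basis (m := #|T|)
    (e := fun i => pihomog mdeg t 'X_[enum_val i : T])).
    exact: ideal_subspace.
  move=> f hf; exists (fun i => f@_(enum_val i : T)).
  rewrite {1}(dhomog_spans hf) (reindex (fun i : 'I_#|T| => enum_val i)).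
    by rewrite subrr; apply: ideal0.
  exact/onW_bij/(@enum_val_bij T).
have [e [he spe inde]] := exb i.
have HFN : hilbert_function X (N + i) = hilbert_function X i.
  by rewrite HFi; apply/germs_onto_hilbert/onto/leq_addr.
have [b [hb spb indb]] : exists b : 'I_(hilbert_function X i) -> P,
    residue_basis [set f : P | f \is (N + i).-homog] I b by rewrite -HFN.
have hsum (c : 'I_(hilbert_function X i) -> K) : \sum_k c k *: e k \is i.-homog.
  by apply: rpred_sum => k _; apply/dhomogZ/he.
have shift_sum (c : 'I_(hilbert_function X i) -> K) :
    \sum_k c k *: (X0 ^+ N * e k) = X0 ^+ N * \sum_k c k *: e k.
  by rewrite mulr_sumr; apply: eq_bigr => k _; rewrite scalerAr.
have hXsum c : X0 ^+ N * (\sum_k c k *: e k) \is (N + i).-homog.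
  by apply: dhomogM => //; apply: dhomogX0.
have indX : independent I (fun k => X0 ^+ N * e k).
  move=> c; rewrite shift_sum => Ic; apply: inde.
  apply: (germs_inj zdX enumX nX0 (hsum c)) => j.
  by rewrite -(germ_shift (@nX0 j) N) // germ_ideal.
have spX : spans [set f : P | f \is (N + i).-homog] I (fun k => X0 ^+ N * e k).
  apply: (independent_spans (ideal_subspace idI) indX _ spb) => _ [k _ <-].
  by apply: spb; apply: dhomogM; [exact: dhomogX0 | exact: he].
have [h hh ha] := onto _ (leq_addr i N) a.
have [c Ic] := spX h hh; exists (\sum_k c k *: e k) => // j.
rewrite -(germ_shift (@nX0 j) N) // -shift_sum -ha.
apply/esym/eqP; rewrite -subr_eq0 -germB //; last by rewrite shift_sum.
by apply/eqP/germ_ideal => //; apply: rpredB => //; rewrite shift_sum.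
Qed.

Lemma germs_onto_regularity i : (regularity_index p <= i)%N -> germs_onto i.
Proof.
move=> ri; apply: hilbert_germs_onto.
pose A := [set r | forall i, (r <= i)%N -> hilbert_function X i = degree p X].
have [AL _] : A (least A) /\ forall k, A k -> (least A <= k)%N.
  apply: leastP; have [N onto] := germs_onto_large.
  by exists N => k Nk; apply/germs_onto_hilbert/onto.
exact: AL.
Qed.

End Surjectivity.

(** * Socle elements and maximal subschemes *)

Section Socle.
Variables (K : fieldType) (n : nat) (X : proj_scheme K n).
Variables (s : nat) (p : 'I_s -> pt_of X).
Local Notation P := {mpoly K[n.+1]}.
Local Notation X0 := ('X_(ord0 : 'I_n.+1) : P).
Local Notation I := (vanishing_ideal X).
Local Notation O j := (stalk (p j)).

Hypothesis zdX : zero_dimensional X.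
Hypothesis enumX : enumerates_Supp p.
Hypothesis nX0 : forall j, ~ prime_ideal (p j) X0.

Let idI : is_ideal I := scheme_ideal X.

Lemma residue_basis_maximal j :
  exists e : 'I_(residue_degree (p j)) -> O j,
    residue_basis setT (@maximal_ideal _ _ X (p j)) e.
Proof.
exact: (stalk_residue_basis zdX enumX nX0 setT (maximal_ideal_subspace (@nX0 j))).
Qed.

Lemma residue_degree_gt0 j : (0 < residue_degree (p j))%N.
Proof.
have [e [_ spe _]] := residue_basis_maximal j; rewrite lt0n; apply/eqP => d0.
have [c] := spe 1 Logic.I; rewrite big1 ?subr0; first exact: (maximal_ideal1 (@nX0 j)).
by case=> k kd; exfalso; move: kd; rewrite d0.
Qed.

(* Multiplying a successively by maximal nonzero powers of the nilpotent      *)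
(* generators of the maximal ideal leads into the socle.                      *)
Lemma nonzero_socle j (a : O j) : a <> 0 ->
  exists v, socle (v * a) /\ v * a <> 0.
Proof.
move=> a0; have [e [me spe _]] :=
  stalk_residue_basis zdX enumX nX0 (@maximal_ideal _ _ X (p j)) (@subspace_set0 _ _).
set m := quot_dim _ _ in e me spe.
suff [v [va ev]] : exists v, v * a <> 0 /\
    forall k, k \in enum 'I_m -> e k * (v * a) = 0.
  exists v; split=> // u /spe [c /= /eqP]; rewrite subr_eq0 => /eqP ->.
  rewrite mulr_suml big1 // => k _.
  by rewrite stalk_scaleAl ev ?scaler0 // mem_enum.
elim: (enum 'I_m) => [|k r [v [va ev]]]; first by exists 1; rewrite mul1r.
have [l el] := maximal_nilpotent zdX enumX nX0 (me k).
have exl : exists l, e k ^+ l * (v * a) == 0 by exists l; rewrite el mul0r.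
case: (ex_minnP exl) => -[|q] /eqP eq0 minq; first by rewrite expr0 mul1r in eq0.
exists (e k ^+ q * v); rewrite -mulrA; split.
  by move=> /eqP /minq; rewrite ltnn.
move=> l'; rewrite inE => /predU1P [->|/ev lr]; first by rewrite mulrA -exprS.
by rewrite mulrCA lr mulr0.
Qed.

Definition principal j (a : O j) : set (O j) := [set u | exists v, u = v * a].

Lemma principal_subspace j (a : O j) : subspace (principal a).
Proof.
split=> [|c _ _ [u ->] [v ->]]; first by exists 0; rewrite mul0r.
by exists (c *: u + v); rewrite mulrDl stalk_scaleAl.
Qed.

(** The annihilator of a nonzero socle element is the maximal ideal, so multiplication by a
    identifies the residue field with the ideal generated by a. *)
Lemma socle_basis j (a : O j) m (e : 'I_m -> O j) : socle a -> a <> 0 ->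
  residue_basis setT (@maximal_ideal _ _ X (p j)) e ->
  residue_basis (principal a) [set 0] (fun k => e k * a).
Proof.
have sumE c : \sum_k c k *: (e k * a) = (\sum_k c k *: e k) * a.
  by rewrite mulr_suml; apply: eq_bigr => k _; rewrite stalk_scaleAl.
move=> sa a0 [_ spe inde]; split=> [k|_ [v ->]|c]; first by exists (e k).
  have [c mc] := spe v Logic.I; exists c.
  by rewrite /= sumE -mulrBl; apply: sa.
rewrite /= sumE => c0; apply: inde; apply: contrapT => /(stalk_inv (@nX0 j)) [w cw].
by apply: a0; rewrite -[a]mul1r -cw mulrAC c0 mul0r.
Qed.

(** * Kernels of restriction and the degree of a subscheme *)

Section Kernel.
Variables (j : 'I_s) (Y : proj_scheme K n).
Hypothesis YX : subscheme Y X.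

Definition restrict_ker k : set (O k) := [set u | @restrict _ _ X Y (p k) u = 0].

Local Notation rho k := (restrict_map (p k) YX).

Lemma restrict_ker_subspace k : subspace (@restrict_ker k).
Proof.
split=> [|c u v]; first exact: (raddf0 (rho k)).
move=> u0 v0; suff : rho k (c *: u + v) = 0 by [].
have [{}u0 {}v0] : rho k u = 0 /\ rho k v = 0 by [].
by rewrite linearP u0 v0 scaler0 addr0.
Qed.

Lemma quot_dim_restrict k :
  (quot_dim [set: local_ring Y (p k)] [set 0%R] +
   quot_dim (@restrict_ker k) [set 0%R])%N
  = quot_dim [set: O k] [set 0].
Proof.
have [e be] := stalk_residue_basis zdX enumX nX0 setT (restrict_ker_subspace k).
have [f bf] := stalk_residue_basis zdX enumX nX0 (@restrict_ker k) (@subspace_set0 _ _).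
have bX := fin_basis_tower (@subspaceT _ _) (restrict_ker_subspace k) _ _ bf be.
rewrite (quot_dim_fin_basis (@subspace_set0 _ _) (bX _ _)) //; last first.
  by move=> _ ->; apply: (restrict_ker_subspace k).1.
have bY := fin_basis_image (g := rho k) (restrict_surj YX) be.
rewrite (quot_dim_fin_basis (@subspace_set0 _ _) bY).
by rewrite card_sum !card_ord addnC.
Qed.

Lemma degree_pj_subscheme :
  (forall k, k != j -> bijective (@restrict _ _ X Y (p k))) ->
  (degree p Y + quot_dim (@restrict_ker j) [set 0%R])%N = degree p X.
Proof.
move=> bij; rewrite /degree (bigD1 j) //= [in RHS](bigD1 j) //= addnAC.
rewrite quot_dim_restrict; congr (_ + _)%N; apply: eq_bigr => k kj.
rewrite -[RHS](quot_dim_restrict k).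
have -> : @restrict_ker k = [set 0].
  apply/seteqP; split=> u /=; last by move=> ->; apply: (restrict_ker_subspace k).1.
  rewrite /restrict_ker /= => u0; apply: (bij_inj (bij k kj)).
  by rewrite u0; apply/esym/(raddf0 (rho k)).
suff -> : quot_dim [set 0%R : O k] [set 0%R] = 0%N by rewrite addn0.
apply: (quot_dim_basis (e := fun=> 0) (@subspace_set0 _ _)).
split=> [[]//|u ->|c _ []//].
by exists (fun=> 0); rewrite big_ord0 subrr.
Qed.

End Kernel.

(** The kernel C at p_j is an ideal of dimension varkappa_j > 0. It contains a nonzero socle
    element, whose principal ideal already has dimension varkappa_j and therefore equals C. *)
Lemma socle_generator_maximal (j : 'I_s) (Y : proj_scheme K n) :
  is_maximal_pj_subscheme p j Y -> exists a, @socle_generator K n X s p j Y a.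
Proof.
move=> [[YX bij _]]; rewrite -(degree_pj_subscheme YX bij) => /addnI /esym dimC.
set C := (X in quot_dim X _) in dimC.
have sC : subspace C := restrict_ker_subspace YX j.
have kerM (u v : O j) : C u -> C (v * u).
  rewrite /C /restrict_ker /=; elim/quotW: u => u; elim/quotW: v => v.
  have -> : (\pi_(local_ring X (p j)) v : O j) * (\pi_(local_ring X (p j)) u : O j)
    = \pi_(local_ring X (p j)) (mulf v u) by apply: local_piM.
  rewrite !restrict_pi // => /local_ring_eq0 [c [d [hc Yc]]].
  apply/local_ring_eq0; exists c, d; split=> //.
  by rewrite fracE /= mulrCA; apply: idealM => //; apply: scheme_ideal.
have [b [Cb spb indb]] : exists b : 'I_(residue_degree (p j)) -> O j,
    residue_basis C [set 0] b.
  rewrite -dimC; exact: (stalk_residue_basis zdX enumX nX0 C (@subspace_set0 _ _)).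
pose k0 := Ordinal (residue_degree_gt0 j).
have b0 : b k0 <> 0.
  move=> b0; have ind0 := indb (fun k => (k == k0)%:R).
  suff /ind0 /(_ k0) /eqP : [set 0] (\sum_k (k == k0)%:R *: b k).
    by rewrite eqxx oner_eq0.
  apply: big1 => k _.
  by case: eqP => [->|_]; rewrite ?b0 ?scaler0 ?scale0r.
have [v [sva va0]] := nonzero_socle b0; exists (v * b k0); split=> // u.
have [e be] := residue_basis_maximal j.
have [pe spe inde] := socle_basis sva va0 be.
have Cv w : C (w * (v * b k0)) by apply: (kerM); apply: (kerM); apply: Cb.
split=> [Cu|[w ->]]; last exact: Cv.
have [|c /= /eqP] := @independent_spans _ _ C [set 0] _ b _
    (@subspace_set0 _ _) inde _ spb u Cu.
  by move=> _ [k _ <-]; apply: spb; apply: Cv.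
rewrite subr_eq0 => /eqP ->; exists (\sum_k c k *: e k).
by rewrite mulr_suml; apply: eq_bigr => k _; rewrite stalk_scaleAl.
Qed.

(** * The maximal subscheme defined by a socle element *)

Section SocleSubscheme.
Variables (j : 'I_s) (a : O j).
Hypothesis (socle_a : socle a) (a_neq0 : a <> 0).

Definition principal_germ i (f : P) : Prop :=
  (forall k, k != j -> germ (p k) i f = 0) /\ principal a (germ (p j) i f).

(** The preimage under germs of the ideal that is generated by a at p_j and is 0 at the other
    points. *)
Definition socle_ideal : set P :=
  [set f | forall d, principal_germ d (pihomog mdeg d f)].

Lemma principal_germ0 i : principal_germ i 0.
Proof. by split=> [k kj|]; rewrite germ0 //; exists 0; rewrite mul0r. Qed.

Lemma principal_germD i f g : f \is i.-homog -> g \is i.-homog ->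
  principal_germ i f -> principal_germ i g -> principal_germ i (f + g).
Proof.
move=> hf hg [f0 pf] [g0 pg]; split=> [k kj|]; rewrite germD //.
  by rewrite f0 // g0 // addr0.
exact: subspaceD (principal_subspace a) pf pg.
Qed.

Lemma principal_germM i k h f : h \is i.-homog -> f \is k.-homog ->
  principal_germ k f -> principal_germ (i + k) (h * f).
Proof.
move=> hh hf [f0 [v pf]]; split=> [l lj|]; rewrite germM //.
  by rewrite f0 // mulr0.
by exists (germ (p j) i h * v); rewrite pf mulrA.
Qed.

Lemma socle_ideal_homogeneous : homogeneous_ideal socle_ideal.
Proof.
split=> [d|f g Jf Jg d|h f Jf d|f i Jf d].
- by rewrite pihomog0; apply: principal_germ0.
- by rewrite pihomogD; apply: principal_germD => //; apply: pihomogP.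
- rewrite pihomogM.
  suff [] : \sum_(i < d.+1) pihomog mdeg i h * pihomog mdeg (d - i) f \is d.-homog /\
    principal_germ d (\sum_(i < d.+1) pihomog mdeg i h * pihomog mdeg (d - i) f) by [].
  apply: (big_ind (fun g => g \is d.-homog /\ principal_germ d g)).
  + by split; [apply: dhomog0 | apply: principal_germ0].
  + move=> f1 f2 [h1 p1] [h2 p2].
    by split; [apply: dhomogD | apply: principal_germD].
  + move=> i _; have id : (i <= d)%N by rewrite -ltnS.
    have := principal_germM (pihomogP mdeg i h) (pihomogP mdeg (d - i) f) (Jf _).
    have := dhomogM (pihomogP mdeg i h) (pihomogP mdeg (d - i) f).
    by rewrite subnKC.
- have [->|ne] := eqVneq i d; first by rewrite pihomog_id.
  by rewrite (pihomog_ne0 ne (pihomogP _ _ _)); apply: principal_germ0.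
Qed.

Lemma socle_ideal_homog i f : f \is i.-homog -> socle_ideal f <-> principal_germ i f.
Proof.
move=> hf; split=> [/(_ i)|pf d]; first by rewrite pihomog_dE.
have [<-|ne] := eqVneq i d; first by rewrite pihomog_dE.
by rewrite (pihomog_ne0 ne hf); apply: principal_germ0.
Qed.

(** It suffices to test with X_0^N, which does not change germs. *)
Lemma socle_ideal_saturated : saturated socle_ideal.
Proof.
move=> f [N Nf] d; have := Nf _ (dhomogX0 _ _ N) (N + d)%N.
have hd := pihomogP mdeg d f.
rewrite (pihomog_homogM _ _ (dhomogX0 _ _ N)) leq_addr addKn => -[f0 pf].
by split=> [k kj|]; [have := f0 k kj | move: pf]; rewrite germ_shift.
Qed.

Definition socle_subscheme : proj_scheme K n :=
  ProjScheme socle_ideal_homogeneous socle_ideal_saturated.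

Lemma socle_subscheme_sub : subscheme socle_subscheme X.
Proof.
move=> f If d; have hd := pihomogP mdeg d f.
have Id : I (pihomog mdeg d f).
  exact: ((homogeneousP f (vanishing_ideal_homogeneous X)).1 If).
by split=> [k kj|]; rewrite germ_ideal //; exists 0; rewrite mul0r.
Qed.

Lemma stalk_frac k (v : frac (p k)) d : v.1 \is d.-homog -> denom (p k) d v.2 ->
  (\pi_(local_ring X (p k)) v : O k) * germ (p k) d v.2 = germ (p k) d v.1.
Proof.
move=> h1 [h2 _]; rewrite /germ local_piM; apply: pi_eq.
by rewrite !fracE !val_germ //=; ring.
Qed.

Lemma restrict_socle_neq k (u : O k) : k != j ->
  restrict socle_subscheme u = 0 -> u = 0.
Proof.
move=> kj; elim/quotW: u => v; have [d [h1 h2]] := fracP v.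
rewrite restrict_pi; last exact: socle_subscheme_sub.
move=> /local_ring_eq0 [c [e [[hc nc]]]].
move=> /(socle_ideal_homog (dhomogM hc h1)) [/(_ k kj) + _]; rewrite germM //.
have [w cw] := germ_inv (@nX0 k) hc nc.
have [w' vw] := germ_inv (@nX0 k) h2.1 h2.2.
rewrite -(stalk_frac h1 h2); set u : O k := \pi v => cv.
have -> : u = u * (germ (p k) e c * w) * (germ (p k) d v.2 * w').
  by rewrite cw vw !mulr1.
have -> : u * (germ (p k) e c * w) * (germ (p k) d v.2 * w') =
    germ (p k) e c * (u * germ (p k) d v.2) * (w * w') by ring.
by rewrite cv mul0r.
Qed.

Lemma restrict_socle_eq0 (u : O j) :
  restrict socle_subscheme u = 0 <-> principal a u.
Proof.
elim/quotW: u => v; have [d [h1 h2]] := fracP v.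
rewrite restrict_pi; last exact: socle_subscheme_sub.
have [w' vw] := germ_inv (@nX0 j) h2.1 h2.2.
split=> [/local_ring_eq0 [c [e [[hc nc]]]]|[w vE]].
  move=> /(socle_ideal_homog (dhomogM hc h1)) [_]; rewrite germM // => -[w fE].
  have [c' cc] := germ_inv (@nX0 j) hc nc.
  exists (c' * w' * w); rewrite -mulrA -fE -(stalk_frac h1 h2).
  set u : O j := \pi v.
  have -> : c' * w' * (germ (p j) e c * (u * germ (p j) d v.2)) =
    u * (germ (p j) e c * c') * (germ (p j) d v.2 * w') by ring.
  by rewrite cc vw !mulr1.
(* The isolating form f is a denominator at p_j and kills the germs of the numerator at all other
   points. *)
have [i [f [hf nf f0]]] := isolating_element zdX enumX nX0 j.
apply/local_ring_eq0; exists f, i; split=> //.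
apply/(socle_ideal_homog (dhomogM hf h1)); split=> [k kj|]; rewrite germM //.
  by rewrite f0 // mul0r.
exists (germ (p j) i f * germ (p j) d v.2 * w).
by rewrite -(stalk_frac h1 h2) vE; ring.
Qed.

Lemma socle_subscheme_maximal :
  is_maximal_pj_subscheme p j socle_subscheme.
Proof.
have bij k : k != j -> bijective (@restrict _ _ X socle_subscheme (p k)).
  move=> kj; have sur := restrict_surj socle_subscheme_sub (x := p k).
  exists (fun v => sval (cid (sur v))) => [u|v]; last exact: svalP (cid (sur v)).
  set u' := sval _.
  have u'E : restrict socle_subscheme u' = restrict socle_subscheme u.
    exact: svalP (cid (sur _)).
  apply/eqP; rewrite -subr_eq0; apply/eqP/(@restrict_socle_neq k) => //.
  rewrite -[LHS]/(restrict_map (p k) socle_subscheme_sub (u' - u)) raddfB.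
  by apply/eqP; rewrite subr_eq0; apply/eqP.
split.
  split=> //; first exact: socle_subscheme_sub.
  exact: restrict_surj socle_subscheme_sub.
rewrite -(degree_pj_subscheme socle_subscheme_sub bij); congr (_ + _)%N.
have [e be] := residue_basis_maximal j.
rewrite -(quot_dim_basis (@subspace_set0 _ _) (socle_basis socle_a a_neq0 be)).
by congr quot_dim; apply/seteqP; split=> u /restrict_socle_eq0.
Qed.

End SocleSubscheme.

End Socle.

(** * The conductor *)

Section Conductor.
Variables (K : fieldType) (n : nat) (X : proj_scheme K n).
Variables (s : nat) (p : 'I_s -> pt_of X).
Local Notation P := {mpoly K[n.+1]}.
Local Notation X0 := ('X_(ord0 : 'I_n.+1) : P).
Local Notation I := (vanishing_ideal X).
Local Notation O j := (stalk (p j)).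

Hypothesis zdX : zero_dimensional X.
Hypothesis enumX : enumerates_Supp p.
Hypothesis nX0 : forall j, ~ prime_ideal (p j) X0.

Lemma coef_itilde f j t : (itilde p f j)`_t = germ (p j) t (pihomog mdeg t f).
Proof.
rewrite /itilde coef_poly; case: ltnP => // /pihomog_small ->.
by rewrite germ0.
Qed.

Lemma R_geP (e : int) (F : Rtilde p) : R_ge p e F <->
  (forall t, exists2 h, h \is t.-homog & forall j, germ (p j) t h = (F j)`_t) /\
  forall j t, t%:Z < e -> (F j)`_t = 0.
Proof.
split=> [[f fe <-]|[lifts Fe]].
  split=> [t|j t te]; last by rewrite coef_itilde fe // germ0.
  by exists (pihomog mdeg t f) => [|j]; [exact: pihomogP | rewrite coef_itilde].
(* [R_ge] asks for components that are zero as polynomials, so the lifts in degrees below e are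
   replaced by 0. *)
pose h t : P := if t%:Z < e then 0 else s2val (cid2 (lifts t)).
have hh t : h t \is t.-homog.
  by rewrite /h; case: ifP => _; [exact: dhomog0 | exact: s2valP (cid2 (lifts t))].
have hF t j : germ (p j) t (h t) = (F j)`_t.
  rewrite /h; case: ifP => [te|_]; first by rewrite germ0 // Fe.
  exact: (s2valP' (cid2 (lifts t)) j).
(* Beyond B all coefficients of F vanish, so finitely many lifts suffice. *)
pose B := (\max_j size (F j))%N.
have hB t : pihomog mdeg t (\sum_(i < B) h i) = if (t < B)%N then h t else 0.
  rewrite linear_sum /=; case: ltnP => [tB|Bt].
    rewrite (bigD1 (Ordinal tB)) //= pihomog_dE // big1 ?addr0 // => i it.
    by rewrite (@pihomog_ne0 _ _ _ i).
  rewrite big1 // => i _; rewrite (@pihomog_ne0 _ _ _ i) //.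
  by rewrite neq_ltn (leq_trans (ltn_ord i)).
exists (\sum_(i < B) h i).
  by move=> t te; rewrite hB /h te if_same.
apply: functional_extensionality_dep => j; apply/polyP => t.
rewrite coef_itilde hB; case: ltnP => [_|Bt]; first exact: hF.
by rewrite germ0 // nth_default // (leq_trans _ Bt) // (leq_bigmax j).
Qed.

Lemma R_imageP (F : Rtilde p) : R_image p F <->
  forall t, exists2 h, h \is t.-homog & forall j, germ (p j) t h = (F j)`_t.
Proof.
have -> : R_image p F <-> R_ge p 0 F.
  by split=> [[f _ fF]|[f _ fF]]; exists f.
by rewrite R_geP; split=> [[]//|lifts].
Qed.

Lemma coef_single j (a : O j) i k t : (single a i k)`_t =
  if t == i then dfwith (fun k => 0 : O k) a k else 0.
Proof.
rewrite /single; case: dfwithP => [|l jl].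
  by rewrite coefZ coefXn dfwith_in; case: eqP; rewrite ?mulr1 ?mulr0.
by rewrite coef0 dfwith_out // if_same.
Qed.

Lemma R_image_single j (a : O j) i : R_image p (single a i) <-> isolated i a.
Proof.
rewrite R_imageP; split=> [/(_ i) [f hf fE]|[f hf [fa f0]] t].
  exists f => //; split=> [|k kj]; rewrite fE coef_single eqxx ?dfwith_in //.
  by rewrite dfwith_out // eq_sym.
have [->|ti] := eqVneq t i; last first.
  exists 0; first exact: dhomog0.
  by move=> k; rewrite germ0 // coef_single (negbTE ti).
exists f => // k; rewrite coef_single eqxx.
by case: dfwithP => [//|l jl]; rewrite f0 // eq_sym.
Qed.

Lemma isolated_coefM t j (f g : {poly O j}) :
  (forall k v, isolated k (v * f`_k)) -> isolated t (f * g)`_t.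
Proof.
move=> isof; rewrite coefM; apply: subspace_sum; first exact: isolated_subspace.
move=> k; apply: (isolated_leq nX0 (i := k)); first by rewrite -ltnS.
by rewrite mulrC.
Qed.

(** Multiplying F by the constant v at position j, and by 0 elsewhere, extracts one component.
    Conversely, a coefficient of a product in degree t involves coefficients of F in degrees at most
    t, and isolation persists in higher degrees. *)
Lemma conductorP (F : Rtilde p) : conductor p F <->
  forall j t (v : O j), isolated t (v * (F j)`_t).
Proof.
split=> [cF j t v|isoF g].
  have /R_imageP /(_ t) [h hh hE] := cF (single v 0).
  exists h => //; split=> [|k kj]; rewrite hE /single.
    by rewrite dfwith_in expr0 -scalerAr mulr1 coefZ.
  by rewrite dfwith_out ?mulr0 ?coef0 // eq_sym.
apply/R_imageP => t; apply: (isolated_sum nX0) => j.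
exact: (isolated_coefM t (g j) (@isoF j)).
Qed.

Lemma mu_leP j (a : O j) i : (mu a <= i)%N <-> isolated i a.
Proof.
have [N onto] := germs_onto_large zdX enumX nX0.
rewrite /mu least_leP; last first.
  exists N; apply/R_image_single.
  have [f hf fa] := onto N (leqnn N) (dfwith (fun k => 0 : O k) a).
  exists f => //; split=> [|k kj]; rewrite fa ?dfwith_in //.
  by rewrite dfwith_out // eq_sym.
split=> [[k /R_image_single iso ki]|iso]; first exact: isolated_leq ki iso.
by exists i => //; apply/R_image_single.
Qed.

(* All admissible choices of socle generator and residue basis give the same  *)
(* maximum: it is bounded by i iff the kernel of restriction is isolated in   *)
(* degree i.                                                                  *)
Lemma mu_subscheme_leP j Y i : is_maximal_pj_subscheme p j Y ->
  (mu_subscheme p j Y <= i)%N <->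
  forall u : O j, restrict Y u = 0 -> isolated i u.
Proof.
move=> mY; have [a ga] := socle_generator_maximal zdX enumX nX0 mY.
have [e be] := residue_basis_maximal zdX enumX nX0 j.
have maxP (b : O j) (f : 'I_(residue_degree (p j)) -> O j) :
    @socle_generator _ _ _ _ p j Y b ->
    residue_basis setT (@maximal_ideal _ _ X (p j)) f ->
    (\max_k mu (f k * b)%R <= i)%N <->
    forall u : O j, restrict Y u = 0 -> isolated i u.
  move=> [sb b0 kb] bf; have [_ spf _] := socle_basis nX0 sb b0 bf.
  split=> [/bigmax_leqP mui u /kb /spf [c /= /eqP]|iso].
    rewrite subr_eq0 => /eqP ->; apply: subspace_sum; first exact: isolated_subspace.
    by move=> k; apply: isolatedZ => //; apply/mu_leP/mui.
  by apply/bigmax_leqP => k _; apply/mu_leP/iso/kb; exists (f k).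
rewrite /mu_subscheme least_leP; last by exists (\max_k mu (e k * a)%R), a, e.
split=> [[m [b [f [gb bf ->]]]]|iso]; first by rewrite (maxP b f).
exists (\max_k mu (e k * a)%R); first by exists a, e.
exact/maxP.
Qed.

(** By [mu_subscheme_leP] the bound concerns the kernel of restriction. A nonzero a has a nonzero
    socle multiple, whose subscheme has its kernel inside the ideal generated by a. *)
Lemma point_degree_leP j i : (point_degree p j <= i)%N <->
  exists a : O j, a <> 0 /\ forall v, isolated i (v * a).
Proof.
have socleY (a : O j) : a <> 0 -> exists Y, is_maximal_pj_subscheme p j Y /\
    forall u : O j, restrict Y u = 0 -> exists v, u = v * a.
  move=> a0; have [v [sva va0]] := nonzero_socle zdX enumX nX0 a0.
  exists (socle_subscheme nX0 (v * a)).
  split; first exact: socle_subscheme_maximal.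
  move=> u /(restrict_socle_eq0 zdX enumX nX0) [w ->].
  by exists (w * v); rewrite mulrA.
rewrite /point_degree least_leP; last first.
  have [|Y [mY _]] := socleY 1; first by apply/eqP; exact: oner_neq0.
  by exists (mu_subscheme p j Y); exists Y.
split=> [[_ [Y mY <-]]|[a [a0 isoa]]].
  rewrite (mu_subscheme_leP _ mY) => iso.
  have [a [_ a0 ka]] := socle_generator_maximal zdX enumX nX0 mY.
  by exists a; split=> // v; apply: iso; apply/ka; exists v.
have [Y [mY Ya]] := socleY a a0.
exists (mu_subscheme p j Y); first by exists Y.
by apply/(mu_subscheme_leP _ mY) => u /Ya [v ->].
Qed.

Lemma CBP_conductor (d : int) : CBP p d <-> conductor p `<=` R_ge p (d + 1).
Proof.
split=> [cbp F /conductorP isoF|sub j].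
  apply/R_geP; split.
    by move=> t; apply: (isolated_sum nX0) => j; rewrite -[_`__]mul1r.
  move=> j t td; apply: contrapT => Fjt.
  have : (point_degree p j <= t)%N by apply/point_degree_leP; exists (F j)`_t.
  by rewrite leqNgt -ltz_nat (lt_le_trans td (cbp j)).
rewrite leNgt; apply/negP => pd.
(* If deg_X(p_j) < d + 1, this a placed in degree deg_X(p_j) is a conductor element with a nonzero
   coefficient below degree d + 1. *)
have [a [a0 iso]] := (point_degree_leP j (point_degree p j)).1 (leqnn _).
have /sub /R_geP [_ /(_ j _ pd)] : conductor p (single a (point_degree p j)).
  apply/conductorP => k t v; rewrite coef_single.
  case: eqP => [->|_]; last by rewrite mulr0; apply: isolated0.
  case: dfwithP v => [v|l _ v]; first exact: iso.
  by rewrite mulr0; apply: isolated0.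
by rewrite coef_single eqxx dfwith_in.
Qed.

Lemma R_ge_regularity : R_ge p (regularity_index p)%:Z `<=` conductor p.
Proof.
move=> F /R_geP [_ F0]; apply/conductorP => j t v.
have [tr|rt] := ltnP t (regularity_index p).
  by rewrite F0 ?ltz_nat // mulr0; apply: isolated0.
have [f hf fE] := germs_onto_regularity zdX enumX nX0 rt
  (dfwith (fun k => 0 : O k) (v * (F j)`_t)).
exists f => //; split=> [|k kj]; rewrite fE ?dfwith_in //.
by rewrite dfwith_out // eq_sym.
Qed.

End Conductor.

Theorem theorem5p4 (K : fieldType) (n : nat) (X : proj_scheme K n)
    (s : nat) (p : 'I_s -> pt_of X) :
  zero_dimensional X ->
  enumerates_Supp p ->
  (forall j, ~ prime_ideal (p j) ('X_(ord0 : 'I_n.+1) : {mpoly K[n.+1]})) ->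
  (forall d : int, 0 <= d <= (regularity_index p)%:Z - 1 ->
     (CBP p d <-> conductor p `<=` R_ge p (d + 1))) /\
  (cayley_bacharach_scheme p <->
     conductor p = R_ge p (regularity_index p)%:Z).
Proof.
move=> zdX enumX nX0; split=> [d _|]; first exact: CBP_conductor.
(* For d = r_X - 1 the bound d + 1 is r_X, and the reverse inclusion always holds. *)
rewrite /cayley_bacharach_scheme CBP_conductor // subrK.
split=> [sub|->//]; apply/seteqP; split=> //.
exact: R_ge_regularity.
Qed.
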